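(* Let $R$ be any ring (not necessarily unital). Then: (i) There are lattice isomorphisms $\mathrm{Lat}_{\mathrm d}(R)\cong \mathrm{Lat}(\Lambda(R))$ and $\mathrm{Lat}_{\mathrm{qp}}(R)\cong \mathrm{Lat}(\mathrm S(R))$. (ii) The lattice $\mathrm{Lat}_{\mathrm{qp}}(R)$ is a complete sublattice of $\mathrm{Lat}_{\mathrm d}(R)$ (and, as a partially ordered set, a retract of $\mathrm{Lat}_{\mathrm d}(R)$). (iii) Given a decomposable ideal $I$ of $R$, we have $\Lambda(R)/\Lambda_R(I)\cong \Lambda(R/I)$. If, furthermore, $I$ is quasipure, then $\mathrm S(R)/\mathrm S(I)\cong \mathrm S(R/I)$.
   Context: Rings are associative and not necessarily unital. $M_\infty(R)$ is the ring of infinite matrices over $R$ with only finitely many nonzero entries. For $x,y\in M_\infty(R)$, $x\precsim_1 y$ means $x=syt$ for some $s,t\in M_\infty(R)$. $x\oplus y$ denotes the infinite matrix represented by the block diagonal matrix $\mathrm{diag}(x,y)$, where $x,y$ are replaced by finite square upper-left corners containing all their nonzero entries. $T(R)=\{(x_n)_{n\ge1}: x_n\in M_\infty(R),\ x_n\precsim_1 x_{n+1}\ \forall n\}$, and $\mathcal S(R)=\{(x_n)\in T(R): \forall n\ \exists y_{n+1}\in M_\infty(R),\ x_n=y_{n+1}x_{n+1}x_n\}$. For $(x_n),(y_n)\in T(R)$ write $(x_n)\precsim(y_n)$ if for every $n$ there is $m$ with $x_n\precsim_1 y_m$, and $(x_n)\sim(y_n)$ if $(x_n)\precsim (y_n)$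 and $(y_n)\precsim(x_n)$. Put $\Lambda(R)=T(R)/{\sim}$ and $\mathrm S(R)=\mathcal S(R)/{\sim}\subseteq\Lambda(R)$. With the order induced by $\precsim$ and addition $[(x_n)]+[(y_n)]=[(x_n\oplus y_n)]$, both are positively ordered commutative monoids in which increasing sequences have suprema. For such a positively ordered monoid $S$, an ideal of $S$ is a (nonempty) subsemigroup $J$ which is downward hereditary ($x\le y$ and $y\in J$ imply $x\in J$) and closed under suprema of increasing sequences; $\mathrm{Lat}(S)$ is the lattice of ideals of $S$ ordered by inclusion. For an ideal $J$ of $S$ and $x,y\in S$: $x\le_J y$ iff $x\le y+z$ for some $z\in J$; $x\sim_J y$ iff $x\le_J y$ and $y\le_J x$; $S/J=S/{\sim_J}$, a positively ordered monoid with the addition induced from $S$ and the order induced by $\le_J$. The isomorphisms in (iii) are of positively ordered monoids. A two-sided ideal $I$ of $R$ is decomposable if for every $x\in M_\infty(I)$ there is $y\in M_\infty(I)$ with $x\precsim_1 y$ in $M_\infty(R)$. It is quasipure if for every $x\in M_\infty(I)$ there are $s,y\in M_\infty(I)$ with $sy=y$ and $x\precsim_1 y$ in $M_\infty(R)$ (so quasipure ideals are decomposable). $\mathrm{Lat}_{\mathrm d}(R)$ and $\mathrm{Lat}_{\mathrm{qp}}(R)\subseteq \mathrm{Lat}_{\mathrm d}(R)$ are the lattices (ordered by inclusion) of decomposable, respectively quasipure, two-sided ideals of $R$. For a two-sided ideal $I$ of $R$, $\Lambda_R(I)=\{[(x_n)]\in\Lambda(R): x_n\in M_\infty(I)\ \forall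 n\}$, an ideal of $\Lambda(R)$; and $\mathrm S(I)$ is the semigroup $\mathrm S$ of the ring $I$, which is identified with $\mathrm S(R)\cap\Lambda_R(I)$ and is an ideal of $\mathrm S(R)$. A partially ordered set $P$ is a retract of a partially ordered set $Q$ if there are order-preserving maps $\varphi\colon P\to Q$ and $\psi\colon Q\to P$ with $\psi\circ\varphi=\mathrm{id}_P$.
   Formalization: ''Complete sublattice'' is proved as: Lat_qp(R) is a complete lattice whose arbitrary suprema agree with those of Lat_d(R); infima need not agree (upper triangular 2×2 matrices over a field: the quasipure ideals generated by e11 and e22 meet in a nonzero square-zero ideal). *)

(* Defs.v *)
(* MathComp, with the classical reasoning of MathComp-Analysis. *)
From HB Require Import structures.
From mathcomp Require Import all_boot all_order all_algebra.
From mathcomp Require Import generic_quotient ring_quotient zify.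
From mathcomp Require Import all_classical.

Set Implicit Arguments.
Unset Strict Implicit.
Unset Printing Implicit Defensive.

Import Order.TTheory GRing.Theory.
Local Open Scope classical_set_scope.
Local Open Scope quotient_scope.
Local Open Scope ring_scope.

HB.mixin Record Zmodule_isRng R of GRing.Zmodule R := {
  rmul : R -> R -> R;
  rmulA : associative rmul;
  rmulDl : left_distributive rmul +%R;
  rmulDr : right_distributive rmul +%R
}.
#[short(type="rngType")]
HB.structure Definition Rng := {R of Zmodule_isRng R & GRing.Zmodule R}.

Notation "x ** y" := (rmul x y) (at level 40, left associativity) : ring_scope.

Section RngTheory.
Variable R : rngType.
Implicit Types x y z : R.

Lemma rmul0 x : x ** 0 = 0.
Proof. by apply: (addrI (x ** 0)); rewrite -rmulDr !addr0. Qed.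

Lemma r0mul x : 0 ** x = 0.
Proof. by apply: (addrI (0 ** x)); rewrite -rmulDl !addr0. Qed.

Lemma rmulrN x y : x ** (- y) = - (x ** y).
Proof. by apply: (addrI (x ** y)); rewrite -rmulDr !subrr rmul0. Qed.

Lemma rmulNr x y : (- x) ** y = - (x ** y).
Proof. by apply: (addrI (x ** y)); rewrite -rmulDl !subrr r0mul. Qed.

Lemma rmul_sumr x (I : Type) (r : seq I) (P : pred I) (F : I -> R) :
  x ** (\sum_(i <- r | P i) F i) = \sum_(i <- r | P i) x ** F i.
Proof. by apply: (big_morph (rmul x)) => [y z|]; rewrite ?rmulDr ?rmul0. Qed.

Lemma rmul_suml x (I : Type) (r : seq I) (P : pred I) (F : I -> R) :
  (\sum_(i <- r | P i) F i) ** x = \sum_(i <- r | P i) F i ** x.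
Proof.
by apply: (big_morph (rmul^~ x)) => [y z|]; rewrite ?rmulDl ?r0mul.
Qed.

End RngTheory.

(* M_oo(R). *)
Record infmx (R : zmodType) := InfMx {
  infmx_fun :> nat -> nat -> R;
  infmx_finite : finite_set [set ij : nat * nat | infmx_fun ij.1 ij.2 != 0]
}.

HB.instance Definition _ (R : zmodType) :=
  Choice.copy (infmx R) {classic (infmx R)}.

Definition corner_bound (R : zmodType) (x : nat -> nat -> R) (n : nat) : Prop :=
  forall i j, (n <= i)%N || (n <= j)%N -> x i j = 0.

Section InfMxZmod.
Variable R : zmodType.
Implicit Types x y z : infmx R.

Lemma infmxP x y : (forall i j, x i j = y i j) -> x = y.
Proof.
case: x y => [f ff] [g gf] /= fg.
have {fg} efg : f = g by apply/funext => i; apply/funext => j.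
by case: _ / efg in gf *; congr InfMx.
Qed.

Lemma finite_corner (f : nat -> nat -> R) n : corner_bound f n ->
  finite_set [set ij : nat * nat | f ij.1 ij.2 != 0].
Proof.
move=> fn; apply: (@sub_finite_set _ _ (`I_n `*` `I_n)).
  move=> [i j] /= fij; split; rewrite ltnNge; apply: contra fij => h;
  by rewrite fn ?h ?orbT.
by apply: finite_setX; exact: finite_II.
Qed.

Lemma corner_exists x : exists n, corner_bound x n.
Proof.
have /finite_seqP [s xs] := infmx_finite x.
exists (\max_(p <- s) maxn p.1 p.2).+1 => i j ij; apply/eqP.
apply: contraTT ij => xij.
have : (i, j) \in s.
  by have : [set` s] (i, j) by rewrite -xs.
move=> /(@leq_bigmax_seq _ s xpredT (fun p => maxn p.1 p.2) (i, j)) /(_ erefl).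
by rewrite negb_or -!ltnNge !ltnS -geq_max.
Qed.

Definition mkinfmx (f : nat -> nat -> R) n (fn : corner_bound f n) : infmx R :=
  InfMx (finite_corner fn).

Lemma corner_exists2 x y : exists n, corner_bound x n /\ corner_bound y n.
Proof.
have [[m xm] [n yn]] := (corner_exists x, corner_exists y).
exists (maxn m n); split => i j; rewrite !geq_max => h.
  by apply: xm; case/orP: h => /andP[-> _]; rewrite ?orbT.
by apply: yn; case/orP: h => /andP[_ ->]; rewrite ?orbT.
Qed.

Lemma infmx_zero_subproof : finite_set [set ij : nat * nat | (0 : R) != 0].
Proof. by apply: (@finite_corner (fun _ _ => 0) 0). Qed.
Definition infmx_zero := @InfMx R (fun _ _ => 0) infmx_zero_subproof.

Lemma infmx_opp_subproof x :
  finite_set [set ij : nat * nat | - x ij.1 ij.2 != 0].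
Proof.
have [n xn] := corner_exists x.
by apply: (@finite_corner (fun i j => - x i j) n) => i j /xn ->; rewrite oppr0.
Qed.
Definition infmx_opp x := @InfMx R (fun i j => - x i j) (infmx_opp_subproof x).

Lemma infmx_add_subproof x y :
  finite_set [set ij : nat * nat | x ij.1 ij.2 + y ij.1 ij.2 != 0].
Proof.
have [n [xn yn]] := corner_exists2 x y.
apply: (@finite_corner (fun i j => x i j + y i j) n) => i j h.
by rewrite xn ?yn ?addr0.
Qed.
Definition infmx_add x y :=
  @InfMx R (fun i j => x i j + y i j) (infmx_add_subproof x y).

Lemma infmx_addA : associative infmx_add.
Proof. by move=> x y z; apply: infmxP => i j; exact: addrA. Qed.
Lemma infmx_addC : commutative infmx_add.
Proof. by move=> x y; apply: infmxP => i j; exact: addrC. Qed.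
Lemma infmx_add0 : left_id infmx_zero infmx_add.
Proof. by move=> x; apply: infmxP => i j; exact: add0r. Qed.
Lemma infmx_addN : left_inverse infmx_zero infmx_opp infmx_add.
Proof. by move=> x; apply: infmxP => i j; exact: addNr. Qed.

HB.instance Definition _ := GRing.isZmodule.Build (infmx R)
  infmx_addA infmx_addC infmx_add0 infmx_addN.

Lemma infmx_addE x y i j : (x + y) i j = x i j + y i j.
Proof. by []. Qed.

Lemma infmx_sumE (I : Type) (r : seq I) (P : pred I) (F : I -> infmx R) i j :
  (\sum_(k <- r | P k) F k) i j = \sum_(k <- r | P k) F k i j.
Proof. by apply: (big_morph (fun x : infmx R => x i j)). Qed.

End InfMxZmod.

Section InfMxRng.
Variable R : rngType.
Implicit Types x y z : infmx R.

Lemma fsum_ord (n : nat) (F : nat -> R) :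
  (forall k, (n <= k)%N -> F k = 0) ->
  \sum_(k \in [set: nat]) F k = \sum_(k < n) F k.
Proof.
move=> Fn; rewrite fsbig_ord; apply/esym/fsbig_widen => // k /= [_].
by move/negP; rewrite -leqNgt => /Fn.
Qed.

Lemma infmx_mul_subproof x y : finite_set
  [set ij : nat * nat | \sum_(k \in [set: nat]) x ij.1 k ** y k ij.2 != 0].
Proof.
have [n [xn yn]] := corner_exists2 x y.
apply: (@finite_corner _ (fun i j => \sum_(k \in [set: nat]) x i k ** y k j) n).
move=> i j /orP h; apply: fsbig1 => k _.
by case: h => h; [rewrite xn ?h // r0mul | rewrite yn ?h ?orbT // rmul0].
Qed.
Definition infmx_mul x y :=
  @InfMx R (fun i j => \sum_(k \in [set: nat]) x i k ** y k j)
    (infmx_mul_subproof x y).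

Lemma infmx_mulE x y i j n :
    (forall k, (n <= k)%N -> x i k ** y k j = 0) ->
  infmx_mul x y i j = \sum_(k < n) x i k ** y k j.
Proof. exact: fsum_ord. Qed.

Lemma infmx_mulEl x y i j n : corner_bound x n ->
  infmx_mul x y i j = \sum_(k < n) x i k ** y k j.
Proof.
by move=> xn; apply: infmx_mulE => k nk; rewrite xn ?nk ?orbT // r0mul.
Qed.

Lemma infmx_mulEr x y i j n : corner_bound y n ->
  infmx_mul x y i j = \sum_(k < n) x i k ** y k j.
Proof.
by move=> xn; apply: infmx_mulE => k nk; rewrite xn ?nk ?orbT // rmul0.
Qed.

Lemma infmx_mulA : associative infmx_mul.
Proof.
move=> x y z; apply: infmxP => i j.
have [[n xn] [m zm]] := (corner_exists x, corner_exists z).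
rewrite (infmx_mulEl _ _ _ xn) (infmx_mulEr _ _ _ zm).
under eq_bigr => k _ do rewrite (infmx_mulEr _ _ _ zm) rmul_sumr.
rewrite exchange_big; apply: eq_bigr => l _.
rewrite (infmx_mulEl _ _ _ xn) rmul_suml; apply: eq_bigr => k _.
exact: rmulA.
Qed.

Lemma infmx_mulDl : left_distributive infmx_mul +%R.
Proof.
move=> x y z; apply: infmxP => i j; have [n zn] := corner_exists z.
rewrite infmx_addE !(infmx_mulEr _ _ _ zn).
by rewrite -big_split; apply: eq_bigr => k _; exact: rmulDl.
Qed.

Lemma infmx_mulDr : right_distributive infmx_mul +%R.
Proof.
move=> z x y; apply: infmxP => i j; have [n zn] := corner_exists z.
rewrite infmx_addE !(infmx_mulEl _ _ _ zn).
by rewrite -big_split; apply: eq_bigr => k _; exact: rmulDr.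
Qed.

HB.instance Definition _ := Zmodule_isRng.Build (infmx R)
  infmx_mulA infmx_mulDl infmx_mulDr.

Definition pre1 x y : Prop := exists s t : infmx R, x = s ** y ** t.

Lemma pre1_trans y x z : pre1 x y -> pre1 y z -> pre1 x z.
Proof.
move=> [s [t ->]] [s' [t' ->]]; exists (s ** s'), (t' ** t).
by rewrite !rmulA.
Qed.

End InfMxRng.

Section Oplus.
Variable R : zmodType.
Implicit Types x y z : infmx R.

Lemma mxsize_subproof x : exists n, `[< corner_bound x n >].
Proof. by have [n xn] := corner_exists x; exists n; apply/asboolP. Qed.

Definition mxsize x : nat := ex_minn (mxsize_subproof x).

Lemma mxsizeP x n : (mxsize x <= n)%N <-> corner_bound x n.
Proof.
rewrite /mxsize; case: ex_minnP => m /asboolP xm mmin; split.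
  move=> mn i j /orP h; apply: xm; apply/orP.
  by case: h => h; [left|right]; exact: leq_trans h.
by move=> xn; apply: mmin; apply/asboolP.
Qed.

Lemma mxsize_bound x : corner_bound x (mxsize x).
Proof. exact/mxsizeP. Qed.

Lemma block_subproof (p q : nat) a b c d : exists n, corner_bound (fun i j =>
  if (i < p)%N then if (j < q)%N then a i j else (b : infmx R) i (j - q)%N
  else if (j < q)%N then (c : infmx R) (i - p)%N j
  else (d : infmx R) (i - p)%N (j - q)%N : R) n.
Proof.
have [[nb hb] [nc hc]] := (corner_exists b, corner_exists c).
have [nd hd] := corner_exists d.
exists (p + q + (nb + nc + nd))%N => i j ij.
have [ip|ip] := ltnP; have [jq|jq] := ltnP.
- by exfalso; lia.
- by apply: hb; lia.
- by apply: hc; lia.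
- by apply: hd; lia.
Qed.

Lemma block_finite p q a b c d : finite_set [set ij : nat * nat |
  (if (ij.1 < p)%N then
     if (ij.2 < q)%N then (a : infmx R) ij.1 ij.2
     else (b : infmx R) ij.1 (ij.2 - q)%N
   else if (ij.2 < q)%N then (c : infmx R) (ij.1 - p)%N ij.2
   else (d : infmx R) (ij.1 - p)%N (ij.2 - q)%N) != 0].
Proof.
have [n hn] := block_subproof p q a b c d.
exact: (finite_corner hn).
Qed.

(* The infinite matrix [a b; c d], where the blocks a, b, c and d are cut off *)
(* to their first p rows (a, b) and their first q columns (a, c).             *)
Definition block p q (a b c d : infmx R) : infmx R :=
  @InfMx R (fun i j =>
    if (i < p)%N then if (j < q)%N then a i j else b i (j - q)%N
    else if (j < q)%N then c (i - p)%N j else d (i - p)%N (j - q)%N)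
  (block_finite p q a b c d).

Lemma blockE p q a b c d i j : block p q a b c d i j =
  if (i < p)%N then if (j < q)%N then a i j else b i (j - q)%N
  else if (j < q)%N then c (i - p)%N j else d (i - p)%N (j - q)%N.
Proof. by []. Qed.

Definition oplus x y : infmx R := block (mxsize x) (mxsize x) x 0 0 y.

Lemma block_id p x : corner_bound x p -> block p p x 0 0 0 = x.
Proof.
move=> xp; apply: infmxP => i j /=.
by have [ip|ip] := ltnP; have [jp|jp] := ltnP => //; rewrite xp ?ip ?jp ?orbT.
Qed.

Lemma oplusx0 x : oplus x 0 = x.
Proof. exact/block_id/mxsize_bound. Qed.

Lemma mxsize0 : mxsize 0 = 0.
Proof. by apply/eqP; rewrite -leqn0; apply/mxsizeP. Qed.

Lemma oplus0x x : oplus 0 x = x.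
Proof. by rewrite /oplus mxsize0; apply: infmxP => i j /=; rewrite !subn0. Qed.

Lemma mxsize_oplus x y : mxsize (oplus x y) = (mxsize x + mxsize y)%N.
Proof.
apply/eqP; rewrite eqn_leq; apply/andP; split.
  apply/mxsizeP => i j h /=.
  have [ip|ip] := ltnP; have [jp|jp] := ltnP => //.
    by exfalso; lia.
  by apply: mxsize_bound; lia.
set n := mxsize (oplus x y).
have hn : corner_bound (oplus x y) n by exact: mxsize_bound.
have xn : (mxsize x <= n)%N.
  apply/mxsizeP => i j h; move: (hn i j h) => /=.
  have xb := @mxsize_bound x.
  by have [ip|ip] := ltnP; have [jp|jp] := ltnP => // _; rewrite xb ?ip ?jp ?orbT.
rewrite -leq_subRL //; apply/mxsizeP => i j h.
have /= := hn (mxsize x + i)%N (mxsize x + j)%N.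
rewrite !ltnNge !leq_addr /= !addKn; apply.
by move: h; rewrite !leq_subLR.
Qed.

Lemma oplusA : associative oplus.
Proof.
move=> x y z; apply: infmxP => i j /=; rewrite mxsize_oplus.
set p := mxsize x; set q := mxsize y.
have e k : (p <= k)%N -> (k < p + q)%N = (k - p < q)%N.
  by move=> pk; rewrite ltn_subLR.
have l k : (k < p)%N -> (k < p + q)%N by move=> /leq_trans -> //; rewrite leq_addr.
have [ip|ip] := ltnP i p; have [jp|jp] := ltnP j p; rewrite ?(l _ ip) ?(l _ jp) ?(e _ ip) ?(e _ jp) ?ip ?jp //.
- by case: ifP.
- by case: ifP.
- by rewrite !subnDA; case: ifP; case: ifP.
Qed.

End Oplus.

Section Pre1Oplus.
Variable R : rngType.
Implicit Types x y z s t a b c d : infmx R.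

Lemma infmx_mul_bound n (x y : infmx R) i j :
    (forall k, (n <= k)%N -> x i k ** y k j = 0) ->
  (x ** y) i j = \sum_(k < n) x i k ** y k j.
Proof. exact: infmx_mulE. Qed.

Lemma block_mul p q r a b c d a' b' c' d' :
    (forall k, (q <= k)%N -> (forall i, a i k = 0 /\ c i k = 0) \/
                             (forall j, a' k j = 0 /\ b' k j = 0)) ->
  block p q a b c d ** block q r a' b' c' d' =
  block p r (a ** a' + b ** c') (a ** b' + b ** d')
            (c ** a' + d ** c') (c ** b' + d ** d').
Proof.
move=> h; apply: infmxP => i j.
have [m [cm dm]] := corner_exists2 c' d'.
have key (u v w z : infmx R) i' j' :
    (forall k, (q <= k)%N -> u i' k ** w k j' = 0) ->
    (forall k, (m <= k)%N -> z k j' = 0) ->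
    (u ** w + v ** z) i' j' =
    \sum_(k < q) u i' k ** w k j' + \sum_(k < m) v i' k ** z k j'.
  move=> hu hz; rewrite infmx_addE (infmx_mul_bound hu); congr (_ + _).
  by apply: infmx_mul_bound => k /hz ->; rewrite rmul0.
rewrite (@infmx_mul_bound (q + m)); last first.
  move=> k qmk /=.
  have qk : (q <= k)%N by apply: leq_trans qmk; rewrite leq_addr.
  rewrite [(k < q)%N]ltnNge qk /=.
  have mk : (m <= k - q)%N by rewrite leq_subRL.
  have -> : (if (j < r)%N then c' (k - q)%N j else d' (k - q)%N (j - r)%N) = 0.
    by case: ifP => _; [rewrite cm ?mk|rewrite dm ?mk].
  by rewrite rmul0.
rewrite big_split_ord [RHS]blockE.
have eq1 (k : 'I_q) : (k < q)%N = true by exact: ltn_ord.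
have eq2 (k : nat) : (q + k < q)%N = false by rewrite ltnNge leq_addr.
under eq_bigr => k _ do rewrite /= !eq1.
under [X in _ + X = _]eq_bigr => k _ do rewrite /= !eq2 addKn.
have ha k i' j' : (q <= k)%N -> a i' k ** a' k j' = 0 /\ c i' k ** a' k j' = 0.
  by case/h => [/(_ i') [-> ->]|/(_ j') [-> _]]; rewrite ?r0mul ?rmul0.
have hb k i' j' : (q <= k)%N -> a i' k ** b' k j' = 0 /\ c i' k ** b' k j' = 0.
  by case/h => [/(_ i') [-> ->]|/(_ j') [_ ->]]; rewrite ?r0mul ?rmul0.
have hc j' k : (m <= k)%N -> c' k j' = 0 by move=> mk; rewrite cm ?mk.
have hd j' k : (m <= k)%N -> d' k j' = 0 by move=> mk; rewrite dm ?mk.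
case: ifP => _; case: ifP => _; apply/esym/key => k hk.
- by case: (ha k i j hk).
- exact: hc.
- by case: (hb k i (j - r)%N hk).
- exact: hd.
- by case: (ha k (i - p)%N j hk).
- exact: hc.
- by case: (hb k (i - p)%N (j - r)%N hk).
- exact: hd.
Qed.

Lemma pre1_zero x : pre1 0 x.
Proof. by exists 0, 0; rewrite rmul0. Qed.

Lemma mulmx_colbound x y q k i : corner_bound y q -> (q <= k)%N ->
  (x ** y) i k = 0.
Proof.
by move=> yq qk; rewrite (@infmx_mul_bound 0) ?big_ord0 // => l _;
  rewrite yq ?qk ?orbT // rmul0.
Qed.

Lemma mul_oplus p r s t s' t' x y q : q = mxsize x ->
  block p q s t 0 0 ** oplus x y ** block q r s' 0 t' 0 =
  block p r (s ** x ** s' + t ** y ** t') 0 0 0.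
Proof.
move=> ->; rewrite block_mul; last first.
  by move=> k qk; right => j; split=> //; apply: mxsize_bound; rewrite qk.
rewrite block_mul; last first.
  move=> k qk; left => i; rewrite !r0mul !rmul0 !addr0.
  by split=> //; exact: mulmx_colbound (mxsize_bound (x:=x)) qk.
by rewrite !(r0mul, rmul0, addr0, add0r).
Qed.

Lemma pre1_add x x' y y' : pre1 x y -> pre1 x' y' -> pre1 (x + x') (oplus y y').
Proof.
move=> [s [t ->]] [s' [t' ->]].
have [p hp] := corner_exists (s ** y ** t + s' ** y' ** t').
exists (block p (mxsize y) s s' 0 0), (block (mxsize y) p t 0 t' 0).
by rewrite mul_oplus // block_id.
Qed.

Lemma pre1_block p q p' q' x x' y y' :
    (forall k j, (p' <= k)%N -> y k j = 0) ->
    (forall k i, (q' <= k)%N -> y i k = 0) ->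
  pre1 x y -> pre1 x' y' ->
  pre1 (block p q x 0 0 x') (block p' q' y 0 0 y').
Proof.
move=> yp yq [s [t ->]] [s' [t' ->]].
exists (block p p' s 0 0 s'), (block q' q t 0 0 t').
rewrite block_mul; last by move=> k qk; right => j; split=> //; exact: yp.
rewrite block_mul; last first.
  move=> k qk; left => i; rewrite !r0mul !rmul0 !addr0; split=> //.
  by rewrite (@infmx_mul_bound 0) ?big_ord0 // => l _; rewrite yq // rmul0.
by rewrite !(r0mul, rmul0, addr0, add0r).
Qed.

Lemma pre1_oplus x x' y y' :
  pre1 x y -> pre1 x' y' -> pre1 (oplus x x') (oplus y y').
Proof.
by apply: pre1_block => k i h; apply: mxsize_bound; rewrite h ?orbT.
Qed.

Lemma pre1_oplusC x x' y y' :
  pre1 x y -> pre1 x' y' -> pre1 (oplus x x') (oplus y' y).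
Proof.
move=> [s [t e]] [s' [t' e']]; rewrite {1}/oplus {3}e e'.
set p := mxsize x; set q := mxsize y'.
exists (block p q 0 s s' 0), (block q p 0 t' t 0).
rewrite block_mul; last first.
  by move=> k qk; right => j; split=> //; apply: mxsize_bound; rewrite qk.
rewrite block_mul; last first.
  move=> k qk; left => i; rewrite !r0mul !rmul0 !addr0.
  by split=> //; exact: mulmx_colbound (mxsize_bound (x:=y')) qk.
by rewrite !(r0mul, rmul0, addr0, add0r).
Qed.

Lemma pre1_oplusl x y z : pre1 x y -> pre1 x (oplus y z).
Proof.
by move=> xy; rewrite -(oplusx0 x); apply: pre1_oplus => //; exact: pre1_zero.
Qed.

Lemma pre1_oplusr x y z : pre1 x y -> pre1 x (oplus z y).
Proof.
by move=> xy; rewrite -(oplus0x x); apply: pre1_oplus => //; exact: pre1_zero.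
Qed.

End Pre1Oplus.

Identity Coercion set_to_fun : set >-> Funclass.

Fact pom_display : Order.disp_t. Proof. exact: Order.Disp tt tt. Qed.
Fact inclusion_display : Order.disp_t. Proof. exact: Order.Disp tt tt. Qed.

(* Commutative monoids with a compatible partial order for which 0 is the     *)
(* least element. The monoid law is kept apart from GRing.add because         *)
(* Hierarchy Builder has no join of GRing.Nmodule and Order.POrder.           *)
HB.mixin Record isPosMonoid M of Order.POrder pom_display M := {
  pom0 : M;
  padd : M -> M -> M;
  paddA : associative padd;
  paddC : commutative padd;
  padd0x : left_id pom0 padd;
  pom0_le : forall x, (pom0 <= x)%O;
  padd_le2l : forall z x y, (x <= y)%O -> (padd z x <= padd z y)%O
}.
#[short(type="pomType")]
HB.structure Definition PosMonoid :=
  {M of isPosMonoid M & Order.POrder pom_display M}.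

Notation "x +p y" := (padd x y) (at level 50, left associativity).

Definition pom_iso (M N : pomType) (f : M -> N) : Prop :=
  [/\ bijective f, f pom0 = pom0, {morph f : x y / x +p y}
    & {mono f : x y / (x <= y)%O}].

HB.factory Record POrder_hasSups d T of Order.POrder d T := {
  sups_exist : forall F : set T, exists s, supremums F s
}.
HB.builders Context d T of POrder_hasSups d T.

Let sup (F : set T) : T := sval (cid (sups_exist F)).

Let supP F : supremums F (sup F).
Proof. exact: svalP (cid (sups_exist F)). Qed.

Let meet (x y : T) : T := sup [set z | (z <= x)%O /\ (z <= y)%O].
Let join (x y : T) : T := sup [set x; y].

Let meetP x y z : (x <= meet y z)%O = (x <= y)%O && (x <= z)%O.
Proof.
have [ub lub] := supP [set w | (w <= y)%O /\ (w <= z)%O].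
apply/idP/andP => [xm|[xy xz]]; last exact: ub.
by split; apply: (le_trans xm); apply: lub => w [].
Qed.

Let joinP x y z : (join x y <= z)%O = (x <= z)%O && (y <= z)%O.
Proof.
have [ub lub] := supP [set x; y].
apply/idP/andP => [jz|[xz yz]].
  by split; apply: (le_trans _ jz); apply: ub; [left|right].
by apply: lub => w [->|->].
Qed.

HB.instance Definition _ :=
  Order.POrder_MeetJoin_isLattice.Build d T meetP joinP.
HB.end.

Section PosMonoidTheory.
Local Open Scope order_scope.
Variable M : pomType.
Implicit Types x y z : M.

Lemma paddx0 x : x +p pom0 = x.
Proof. by rewrite paddC padd0x. Qed.

Lemma paddACA : interchange (@padd M) (@padd M).
Proof. by move=> x y z t; rewrite -!paddA (paddA y) (paddC y z) !paddA. Qed.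

Lemma padd_le2r z x y : x <= y -> x +p z <= y +p z.
Proof. by move=> xy; rewrite ![_ +p z]paddC; exact: padd_le2l. Qed.

Lemma padd_leD x x' y y' : x <= y -> x' <= y' -> x +p x' <= y +p y'.
Proof.
by move=> /(padd_le2r x') h /(padd_le2l y); exact: le_trans.
Qed.

Lemma padd_leDl x y : x <= x +p y.
Proof. by rewrite -[leLHS]paddx0; apply/padd_le2l/pom0_le. Qed.

(* "Increasing" means nondecreasing. Suprema are taken in M. *)
Record pideal := PIdeal {
  pideal_set :> set M;
  pideal_nonempty : pideal_set !=set0;
  pidealD : forall x y, pideal_set x -> pideal_set y -> pideal_set (x +p y);
  pideal_down : forall x y, x <= y -> pideal_set y -> pideal_set x;
  pideal_sup : forall (u : nat -> M) (s : M),
    {homo u : m n / (m <= n)%N >-> m <= n} ->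
    (forall n, pideal_set (u n)) -> supremums (range u) s -> pideal_set s
}.

HB.instance Definition _ := Choice.copy pideal {classic pideal}.

Lemma pideal_inj (I J : pideal) : (I : set M) = J -> I = J.
Proof.
case: I J => [I ? ? ? ?] [J ? ? ? ?] /= eIJ; subst J.
by congr PIdeal; exact: Prop_irrelevance.
Qed.

Definition pideal_le (I J : pideal) : bool := `[< I `<=` J >].

Lemma pideal_le_refl : reflexive pideal_le.
Proof. by move=> I; apply/asboolP. Qed.

Lemma pideal_le_anti : antisymmetric pideal_le.
Proof.
by move=> I J /andP[/asboolP IJ /asboolP JI]; apply/pideal_inj/seteqP.
Qed.

Lemma pideal_le_trans : transitive pideal_le.
Proof.
by move=> J I K /asboolP IJ /asboolP JK; apply/asboolP; exact: subset_trans JK.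
Qed.

HB.instance Definition _ := Order.Le_isPOrder.Build inclusion_display pideal
  pideal_le_refl pideal_le_anti pideal_le_trans.

Lemma pideal0 (J : pideal) : J pom0.
Proof.
by have [x Jx] := pideal_nonempty J; apply: pideal_down Jx; exact: pom0_le.
Qed.

Section Gen.
Variable A : set M.

Let gen : set M := \bigcap_(J in [set J : pideal | A `<=` J]) J.

Lemma pideal_gen_nonempty : gen !=set0.
Proof. by exists pom0 => J _; exact: pideal0. Qed.
Lemma pideal_genD x y : gen x -> gen y -> gen (x +p y).
Proof. by move=> gx gy J AJ; apply: pidealD; [exact: gx|exact: gy]. Qed.
Lemma pideal_gen_down x y : x <= y -> gen y -> gen x.
Proof. by move=> xy gy J AJ; apply: pideal_down xy _; exact: gy. Qed.
Lemma pideal_gen_sup (u : nat -> M) s :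
  {homo u : m n / (m <= n)%N >-> m <= n} ->
  (forall n, gen (u n)) -> supremums (range u) s -> gen s.
Proof.
move=> hu gu us J AJ; apply: pideal_sup hu _ us => n; exact: gu.
Qed.

Definition pideal_gen : pideal :=
  PIdeal pideal_gen_nonempty pideal_genD pideal_gen_down pideal_gen_sup.

End Gen.

Lemma pideal_sups_exist (F : set pideal) : exists s, supremums F s.
Proof.
exists (pideal_gen (\bigcup_(J in F) J)); split => [J FJ|K FK].
  by apply/asboolP => x Jx /= L AL; apply: AL; exists J.
apply/asboolP => x /= gx; apply: (gx K) => y [J FJ Jy].
by have /asboolP := FK J FJ; apply.
Qed.

HB.instance Definition _ :=
  POrder_hasSups.Build inclusion_display pideal pideal_sups_exist.

End PosMonoidTheory.

(* Lat(M), ordered by inclusion. *)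
Notation Lat M := (pideal M).

Section PosMonoidQuotient.
Local Open Scope order_scope.
Variables (M : pomType) (J : pideal M).
Implicit Types x y z : M.

Definition lemod x y : Prop := exists2 z, J z & x <= y +p z.
Definition eqvmod x y : bool := `[< lemod x y /\ lemod y x >].

Lemma lemod_refl x : lemod x x.
Proof. by exists pom0; [exact: pideal0|rewrite paddx0]. Qed.

Lemma lemod_trans y x z : lemod x y -> lemod y z -> lemod x z.
Proof.
move=> [a Ja xa] [b Jb yb]; exists (b +p a); first exact: pidealD.
by rewrite paddA; apply: le_trans xa _; exact: padd_le2r.
Qed.

Lemma lemodD x x' y y' : lemod x y -> lemod x' y' -> lemod (x +p x') (y +p y').
Proof.
move=> [a Ja xa] [b Jb yb]; exists (a +p b); first exact: pidealD.
by rewrite paddACA; exact: padd_leD.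
Qed.

Lemma le_lemod x y : x <= y -> lemod x y.
Proof. by move=> xy; exists pom0; [exact: pideal0|rewrite paddx0]. Qed.

Lemma eqvmod_is_equiv : equiv_class_of eqvmod.
Proof.
split=> [x|x y|y x z].
- by apply/asboolP; split; exact: lemod_refl.
- by apply: asbool_equiv_eq; tauto.
- move=> /asboolP[xy yx] /asboolP[yz zy]; apply/asboolP.
  by split; [exact: lemod_trans yz|exact: lemod_trans yx].
Qed.

Canonical eqvmod_equiv := EquivRelPack eqvmod_is_equiv.
Canonical eqvmod_encModRel := defaultEncModRel eqvmod.

Definition pquot : Type := {eq_quot eqvmod}.
HB.instance Definition _ := Choice.on pquot.
HB.instance Definition _ : EqQuotient M eqvmod pquot := EqQuotient.on pquot.

Implicit Types a b c : pquot.

Lemma pquot_piP x y :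
  reflect (lemod x y /\ lemod y x) (\pi_pquot x == \pi_pquot y).
Proof. by rewrite piE; exact: asboolP. Qed.

Lemma pquot_repr x :
  lemod x (repr (\pi_pquot x)) /\ lemod (repr (\pi_pquot x)) x.
Proof. by apply/pquot_piP; rewrite reprK. Qed.

Definition pquot_le a b : bool := `[< lemod (repr a) (repr b) >].
Definition pquot_zero : pquot := \pi_pquot pom0.
Definition pquot_add a b : pquot := \pi_pquot (repr a +p repr b).

Lemma pquot_le_pi x y : pquot_le (\pi_pquot x) (\pi_pquot y) <-> lemod x y.
Proof.
have [xr rx] := pquot_repr x; have [yr ry] := pquot_repr y.
split=> [/asboolP h|h]; last apply/asboolP.
  exact: (lemod_trans xr (lemod_trans h ry)).
exact: (lemod_trans rx (lemod_trans h yr)).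
Qed.

Lemma pquot_add_pi x y : pquot_add (\pi_pquot x) (\pi_pquot y) = \pi_pquot (x +p y).
Proof.
have [xr rx] := pquot_repr x; have [yr ry] := pquot_repr y.
by apply/eqP/pquot_piP; split; exact: lemodD.
Qed.

Lemma pquot_le_refl : reflexive pquot_le.
Proof. by move=> a; apply/asboolP; exact: lemod_refl. Qed.
Lemma pquot_le_anti : antisymmetric pquot_le.
Proof.
move=> a b /andP[/asboolP ab /asboolP ba].
by rewrite -[a]reprK -[b]reprK; apply/eqP/pquot_piP.
Qed.
Lemma pquot_le_trans : transitive pquot_le.
Proof.
by move=> b a c /asboolP ab /asboolP bc; apply/asboolP; exact: lemod_trans ab bc.
Qed.

HB.instance Definition _ := Order.Le_isPOrder.Build pom_display pquot
  pquot_le_refl pquot_le_anti pquot_le_trans.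

Lemma pquot_addA : associative pquot_add.
Proof.
move=> a b c; rewrite -[a]reprK -[b]reprK -[c]reprK.
by rewrite !pquot_add_pi !reprK paddA.
Qed.
Lemma pquot_addC : commutative pquot_add.
Proof.
by move=> a b; rewrite -[a]reprK -[b]reprK !pquot_add_pi paddC.
Qed.
Lemma pquot_add0 : left_id pquot_zero pquot_add.
Proof.
by move=> a; rewrite -[a]reprK pquot_add_pi padd0x.
Qed.

Lemma pquot_ge0 a : (pquot_zero <= a)%O.
Proof. by rewrite -[a]reprK; apply/pquot_le_pi/le_lemod/pom0_le. Qed.

Lemma pquot_leD2l c a b : (a <= b)%O -> (pquot_add c a <= pquot_add c b)%O.
Proof.
rewrite -[a]reprK -[b]reprK -[c]reprK => /pquot_le_pi ab.
rewrite !pquot_add_pi.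
by apply/pquot_le_pi/lemodD => //; exact: lemod_refl.
Qed.

HB.instance Definition _ := isPosMonoid.Build pquot
  pquot_addA pquot_addC pquot_add0 pquot_ge0 pquot_leD2l.

End PosMonoidQuotient.

(* T(R). Sequences are indexed from 0. *)
Record incseq (R : rngType) := IncSeq {
  incseq_fun :> nat -> infmx R;
  incseq_pre1 : forall n, pre1 (incseq_fun n) (incseq_fun n.+1)
}.

HB.instance Definition _ (R : rngType) :=
  Choice.copy (incseq R) {classic (incseq R)}.

Section Lambda.
Variable R : rngType.
Implicit Types x y z : incseq R.

Definition precsim x y : Prop := forall n, exists m, pre1 (x n) (y m).
Definition simseq x y : bool := `[< precsim x y /\ precsim y x >].

Lemma precsim_refl x : precsim x x.
Proof. by move=> n; exists n.+1; exact: incseq_pre1. Qed.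

Lemma precsim_trans y x z : precsim x y -> precsim y z -> precsim x z.
Proof.
move=> xy yz n; have [m xm] := xy n; have [k yk] := yz m.
by exists k; exact: pre1_trans yk.
Qed.

Lemma pre1_incseq x m n : (m < n)%N -> pre1 (x m) (x n).
Proof.
move=> /subnKC <-; elim: (n - m.+1)%N => [|k IH].
  by rewrite addn0; exact: incseq_pre1.
by rewrite addnS; apply: pre1_trans IH _; exact: incseq_pre1.
Qed.

Lemma pre1_incseq_trans (a : infmx R) x m n :
  (m <= n)%N -> pre1 a (x m) -> pre1 a (x n).
Proof.
rewrite leq_eqVlt => /predU1P[<-//|/(pre1_incseq x) h /pre1_trans]; exact.
Qed.

Lemma simseq_is_equiv : equiv_class_of simseq.
Proof.
split=> [x|x y|y x z].
- by apply/asboolP; split; exact: precsim_refl.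
- by apply: asbool_equiv_eq; tauto.
- move=> /asboolP[xy yx] /asboolP[yz zy]; apply/asboolP.
  by split; [exact: precsim_trans yz|exact: precsim_trans yx].
Qed.

Canonical simseq_equiv := EquivRelPack simseq_is_equiv.
Canonical simseq_encModRel := defaultEncModRel simseq.

Definition Lambda : Type := {eq_quot simseq}.
HB.instance Definition _ := Choice.on Lambda.
HB.instance Definition _ : EqQuotient (incseq R) simseq Lambda :=
  EqQuotient.on Lambda.

Implicit Types a b c : Lambda.

Lemma Lambda_piP x y :
  reflect (precsim x y /\ precsim y x) (\pi_Lambda x == \pi_Lambda y).
Proof. by rewrite piE; exact: asboolP. Qed.

Lemma Lambda_repr x :
  precsim x (repr (\pi_Lambda x)) /\ precsim (repr (\pi_Lambda x)) x.
Proof. by apply/Lambda_piP; rewrite reprK. Qed.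

Definition zero_seq : incseq R :=
  @IncSeq R (fun=> 0) (fun=> pre1_zero 0).

Definition oplus_seq x y : incseq R :=
  @IncSeq R (fun n => oplus (x n) (y n))
    (fun n => pre1_oplus (incseq_pre1 x n) (incseq_pre1 y n)).

Definition Lambda_le a b : bool := `[< precsim (repr a) (repr b) >].
Definition Lambda_zero : Lambda := \pi_Lambda zero_seq.
Definition Lambda_add a b : Lambda := \pi_Lambda (oplus_seq (repr a) (repr b)).

Lemma precsim_oplus x x' y y' : precsim x y -> precsim x' y' ->
  precsim (oplus_seq x x') (oplus_seq y y').
Proof.
move=> xy xy' n; have [m h] := xy n; have [m' h'] := xy' n.
exists (maxn m m') => /=; apply: pre1_oplus.
  by apply: pre1_incseq_trans h; exact: leq_maxl.
by apply: pre1_incseq_trans h'; exact: leq_maxr.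
Qed.

Lemma Lambda_le_pi x y :
  Lambda_le (\pi_Lambda x) (\pi_Lambda y) <-> precsim x y.
Proof.
have [xr rx] := Lambda_repr x; have [yr ry] := Lambda_repr y.
split=> [/asboolP h|h]; last apply/asboolP.
  exact: (precsim_trans xr (precsim_trans h ry)).
exact: (precsim_trans rx (precsim_trans h yr)).
Qed.

Lemma Lambda_add_pi x y :
  Lambda_add (\pi_Lambda x) (\pi_Lambda y) = \pi_Lambda (oplus_seq x y).
Proof.
have [xr rx] := Lambda_repr x; have [yr ry] := Lambda_repr y.
by apply/eqP/Lambda_piP; split; exact: precsim_oplus.
Qed.

Lemma Lambda_le_refl : reflexive Lambda_le.
Proof. by move=> a; apply/asboolP; exact: precsim_refl. Qed.
Lemma Lambda_le_anti : antisymmetric Lambda_le.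
Proof.
move=> a b /andP[/asboolP ab /asboolP ba].
by rewrite -[a]reprK -[b]reprK; apply/eqP/Lambda_piP.
Qed.
Lemma Lambda_le_trans : transitive Lambda_le.
Proof.
by move=> b a c /asboolP ab /asboolP bc; apply/asboolP; exact: precsim_trans bc.
Qed.

HB.instance Definition _ := Order.Le_isPOrder.Build pom_display Lambda
  Lambda_le_refl Lambda_le_anti Lambda_le_trans.

Lemma incseqP x y : (forall n, x n = y n) -> x = y.
Proof.
case: x y => [x ?] [y ?] /= /funext exy; subst y.
by congr IncSeq; exact: Prop_irrelevance.
Qed.

Lemma Lambda_addA : associative Lambda_add.
Proof.
move=> a b c; elim/quotW: a => x; elim/quotW: b => y; elim/quotW: c => z.
rewrite (Lambda_add_pi x y) (Lambda_add_pi y z).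
rewrite (Lambda_add_pi x) (Lambda_add_pi _ z).
by congr (\pi_Lambda _); apply: incseqP => n; exact: oplusA.
Qed.

Lemma Lambda_addC : commutative Lambda_add.
Proof.
move=> a b; elim/quotW: a => x; elim/quotW: b => y; rewrite !Lambda_add_pi.
apply/eqP/Lambda_piP.
by split=> n; exists n.+1; apply: pre1_oplusC; exact: incseq_pre1.
Qed.

Lemma Lambda_add0 : left_id Lambda_zero Lambda_add.
Proof.
move=> a; elim/quotW: a => x; rewrite Lambda_add_pi.
by congr (\pi_Lambda _); apply: incseqP => n; exact: oplus0x.
Qed.

Lemma Lambda_ge0 a : (Lambda_zero <= a)%O.
Proof.
by elim/quotW: a => x; apply/Lambda_le_pi => n; exists 0; exact: pre1_zero.
Qed.

Lemma Lambda_leD2l c a b :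
  (a <= b)%O -> (Lambda_add c a <= Lambda_add c b)%O.
Proof.
elim/quotW: a => x; elim/quotW: b => y; elim/quotW: c => z.
move=> /Lambda_le_pi xy; rewrite !Lambda_add_pi; apply/Lambda_le_pi.
by apply: precsim_oplus => //; exact: precsim_refl.
Qed.

HB.instance Definition _ := isPosMonoid.Build Lambda
  Lambda_addA Lambda_addC Lambda_add0 Lambda_ge0 Lambda_leD2l.

(* The set of sequences called \mathcal S(R). *)
Definition calS : set (incseq R) :=
  [set x | forall n, exists y : infmx R, x n = y ** x n.+1 ** x n].

Lemma calS_zero : calS zero_seq.
Proof. by move=> n; exists 0; rewrite !rmul0. Qed.

Lemma calS_pre1 (x y z : infmx R) : x = y ** z ** x -> pre1 x z.
Proof. by move=> xE; exists y, x. Qed.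

(* Over a non-unital ring (x_n (+) y_n) need not lie in calS R when (x_n) and *)
(* (y_n) do, as the corners of x_n and x_n.+1 may have different sizes; the   *)
(* equivalent sequence asum x y does.                                         *)
Definition asum_cut x n := maxn (mxsize (x n)) (mxsize (x n.-1)).

Definition asum_fun x y n : infmx R :=
  block (asum_cut x n.+1) (asum_cut x n) (x n) 0 0 (y n).

Lemma asum_cutl x n k j : (asum_cut x n.+1 <= k)%N -> x n k j = 0.
Proof. by rewrite geq_max /= => /andP[_ h]; apply: mxsize_bound; rewrite h. Qed.

Lemma asum_cutr x n k i : (asum_cut x n <= k)%N -> x n i k = 0.
Proof.
by rewrite geq_max /= => /andP[h _]; apply: mxsize_bound; rewrite h orbT.
Qed.

Lemma asum_pre1 x y n : pre1 (asum_fun x y n) (asum_fun x y n.+1).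
Proof.
apply: pre1_block => [k j|k j||]; [exact: asum_cutl|exact: asum_cutr| |];
exact: incseq_pre1.
Qed.

Definition asum x y : incseq R := IncSeq (asum_pre1 x y).

Lemma asum_oplus x y : \pi_Lambda (asum x y) = \pi_Lambda (oplus_seq x y).
Proof.
apply/eqP/Lambda_piP; split=> n; exists n.+1.
  apply: pre1_block; try exact: incseq_pre1.
    by move=> k j h; apply: mxsize_bound; rewrite h.
  by move=> k j h; apply: mxsize_bound; rewrite h orbT.
by apply: pre1_block; try exact: incseq_pre1;
  [exact: asum_cutl|exact: asum_cutr].
Qed.

Lemma calS_asum x y : calS x -> calS y -> calS (asum x y).
Proof.
move=> Sx Sy n; have [u ux] := Sx n; have [v vy] := Sy n.
exists (block (asum_cut x n.+1) (asum_cut x n.+2) u 0 0 v) => /=.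
rewrite /asum_fun block_mul; last first.
  by move=> k qk; right => j; split=> //; exact: asum_cutl.
rewrite block_mul; last first.
  by move=> k qk; right => j; split=> //; exact: asum_cutl.
by rewrite !(r0mul, rmul0, addr0, add0r) -ux -vy.
Qed.

Lemma pre1_asuml (a : infmx R) x y n : pre1 a (x n) -> pre1 a (asum x y n).
Proof.
move=> ax; have [p ap] := corner_exists a; rewrite -(block_id ap).
by apply: pre1_block => //; [exact: asum_cutl|exact: asum_cutr|exact: pre1_zero].
Qed.

Lemma calS_asuml x y n : calS x ->
  exists z : infmx R, x n = z ** asum x y n.+1 ** x n.
Proof.
move=> Sx; have [u ux] := Sx n; have [p up] := corner_exists u.
set m := maxn p (maxn (mxsize (x n)) (asum_cut x n.+1)).
have e : block (asum_cut x n.+1) m (x n) 0 0 0 = x n.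
  apply: infmxP => i j; rewrite blockE.
  have xn := @mxsize_bound _ (x n).
  have [ip|ip] := ltnP; have [jq|jq] := ltnP => //.
  - by rewrite xn //; apply/orP; right; lia.
  - by rewrite asum_cutl.
  - by rewrite asum_cutl.
exists (block m (asum_cut x n.+2) u 0 0 0).
rewrite /= /asum_fun block_mul; last first.
  by move=> k qk; right => j; split=> //; exact: asum_cutl.
rewrite -{2}e block_mul; last first.
  by move=> k qk; right => j; split=> //; exact: asum_cutl.
rewrite !(r0mul, rmul0, addr0, add0r) -ux.
apply: infmxP => i j; rewrite blockE.
have xn := @mxsize_bound _ (x n).
by have [ip|ip] := ltnP; have [jq|jq] := ltnP => //; apply: xn; lia.
Qed.

Fixpoint sum_seq (X : nat -> incseq R) k : incseq R :=
  if k is k'.+1 then asum (sum_seq X k') (X k) else X 0%N.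

Lemma pre1_sum_seq (X : nat -> incseq R) (a : infmx R) k k' n : (k <= k')%N ->
  pre1 a (sum_seq X k n) -> pre1 a (sum_seq X k' n).
Proof.
by move=> /subnKC <- h; elim: (k' - k)%N => [|d IH]; rewrite ?addn0 // addnS;
  exact: pre1_asuml.
Qed.

Lemma sum_seq_diag (X : nat -> incseq R) n :
  pre1 (sum_seq X n n) (sum_seq X n.+1 n.+1).
Proof. by apply: (pre1_sum_seq (leqnSn n)); exact: incseq_pre1. Qed.

Definition sup_seq (X : nat -> incseq R) : incseq R :=
  @IncSeq R (fun n => sum_seq X n n) (sum_seq_diag X).

Lemma sup_seq_ge (X : nat -> incseq R) k : precsim (X k) (sup_seq X).
Proof.
move=> n; pose N := (maxn k n).+1; exists N; rewrite -[sup_seq X N]/(sum_seq X N N).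
have kN : (k <= N)%N by rewrite leqW ?leq_maxl.
have nN : (n < N)%N by rewrite ltnS leq_maxr.
move: N kN nN => N kN nN; apply: (pre1_sum_seq kN).
have h : pre1 (X k n) (X k N) by exact: pre1_incseq.
case: k kN h => [//|k] _ h; rewrite -(oplus0x (X k.+1 n)).
apply: pre1_block => //; [exact: asum_cutl|exact: asum_cutr|exact: pre1_zero].
Qed.

Lemma calS_sup_seq (X : nat -> incseq R) :
  (forall k, calS (X k)) -> calS (sup_seq X).
Proof.
move=> SX n /=; apply: calS_asuml.
by elim: n => [|n IH]; [exact: SX|exact: calS_asum].
Qed.

Definition mx_in (I : set R) : set (infmx R) :=
  [set x | forall i j, I (x i j)].

Lemma mx_in_sup_seq (I : set R) (X : nat -> incseq R) : I 0 ->
  (forall k n, mx_in I (X k n)) -> forall n, mx_in I (sup_seq X n).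
Proof.
move=> I0 IX n /=; move: {2}n => m; elim: n m => [|n IH] m; first exact: IX.
move=> i j; rewrite [sum_seq _ _ _]/= blockE.
by case: ifP => _; case: ifP => _ //; [exact: IH|exact: IX].
Qed.

Definition S_pred : {pred Lambda} :=
  [pred a | `[< exists2 x, calS x & a = \pi_Lambda x >]].

End Lambda.

Arguments calS R : clear implicits.
Arguments S_pred R : clear implicits.

(* S(R), as a subset of Lambda(R). *)
Record Smon (R : rngType) := SMon {
  Smon_val :> Lambda R;
  Smon_valP : Smon_val \in S_pred R
}.

HB.instance Definition _ (R : rngType) := [isSub for @Smon_val R].
HB.instance Definition _ (R : rngType) := [Choice of Smon R by <:].
HB.instance Definition _ (R : rngType) :=
  [SubChoice_isSubPOrder of Smon R by <: with pom_display].

Section Smon.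
Variable R : rngType.
Implicit Types a b c : Smon R.

Lemma S_pred_pi (x : incseq R) : calS R x -> \pi_(Lambda R) x \in S_pred R.
Proof. by move=> Sx; apply: asboolT; exists x. Qed.

Lemma S_predP (a : Lambda R) :
  reflect (exists2 x, calS R x & a = \pi_(Lambda R) x) (a \in S_pred R).
Proof. exact: asboolP. Qed.

Lemma S_pred0 : (pom0 : Lambda R) \in S_pred R.
Proof. exact: (S_pred_pi (@calS_zero R)). Qed.

Lemma S_predD (a b : Lambda R) :
  a \in S_pred R -> b \in S_pred R -> a +p b \in S_pred R.
Proof.
move=> /S_predP[x Sx ->] /S_predP[y Sy ->].
rewrite [_ +p _]Lambda_add_pi -asum_oplus.
exact: (S_pred_pi (calS_asum Sx Sy)).
Qed.

Definition Smon_zero : Smon R := SMon S_pred0.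
Definition Smon_add a b : Smon R := SMon (S_predD (Smon_valP a) (Smon_valP b)).

Lemma Smon_addA : associative Smon_add.
Proof. by move=> a b c; apply: val_inj; exact: paddA. Qed.
Lemma Smon_addC : commutative Smon_add.
Proof. by move=> a b; apply: val_inj; exact: paddC. Qed.
Lemma Smon_add0 : left_id Smon_zero Smon_add.
Proof. by move=> a; apply: val_inj; exact: padd0x. Qed.
Lemma Smon_ge0 a : (Smon_zero <= a)%O.
Proof. by rewrite leEsub; exact: pom0_le. Qed.
Lemma Smon_leD2l c a b : (a <= b)%O -> (Smon_add c a <= Smon_add c b)%O.
Proof. by rewrite !leEsub; exact: padd_le2l. Qed.

HB.instance Definition _ := isPosMonoid.Build (Smon R)
  Smon_addA Smon_addC Smon_add0 Smon_ge0 Smon_leD2l.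

End Smon.

Section Ideals.
Variable R : rngType.

Record ideal := Ideal {
  ideal_set :> set R;
  ideal0 : ideal_set 0;
  idealB : forall x y, ideal_set x -> ideal_set y -> ideal_set (x - y);
  ideal_mull : forall a x, ideal_set x -> ideal_set (a ** x);
  ideal_mulr : forall a x, ideal_set x -> ideal_set (x ** a)
}.

HB.instance Definition _ := Choice.copy ideal {classic ideal}.

Lemma ideal_inj (I J : ideal) : (I : set R) = J -> I = J.
Proof.
case: I J => [I ? ? ? ?] [J ? ? ? ?] /= eIJ; subst J.
by congr Ideal; exact: Prop_irrelevance.
Qed.

Definition ideal_le (I J : ideal) : bool := `[< I `<=` J >].

Lemma ideal_le_refl : reflexive ideal_le.
Proof. by move=> I; apply/asboolP. Qed.
Lemma ideal_le_anti : antisymmetric ideal_le.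
Proof.
by move=> I J /andP[/asboolP IJ /asboolP JI]; apply/ideal_inj/seteqP.
Qed.
Lemma ideal_le_trans : transitive ideal_le.
Proof.
by move=> J I K /asboolP IJ /asboolP JK; apply/asboolP; exact: subset_trans JK.
Qed.

HB.instance Definition _ := Order.Le_isPOrder.Build inclusion_display ideal
  ideal_le_refl ideal_le_anti ideal_le_trans.

Implicit Type I : ideal.

Lemma idealN I x : I x -> I (- x).
Proof. by rewrite -[- x]add0r; apply: idealB; exact: ideal0. Qed.

Lemma idealD I x y : I x -> I y -> I (x + y).
Proof. by move=> Ix Iy; rewrite -[y]opprK; apply: idealB => //; exact: idealN. Qed.

Lemma ideal_sum I (K : Type) (r : seq K) (P : pred K) (F : K -> R) :
  (forall k, P k -> I (F k)) -> I (\sum_(k <- r | P k) F k).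
Proof. by move=> h; elim/big_ind: _ => //; [exact: ideal0|exact: idealD]. Qed.

Lemma mx_in_mull I (s x : infmx R) : mx_in I x -> mx_in I (s ** x).
Proof.
move=> Ix i j; have [n xn] := corner_exists x.
rewrite (infmx_mul_bound (n := n)) => [|k nk]; last by rewrite xn ?nk ?rmul0.
by apply: ideal_sum => k _; apply: ideal_mull; exact: Ix.
Qed.

Lemma mx_in_mulr I (x t : infmx R) : mx_in I x -> mx_in I (x ** t).
Proof.
move=> Ix i j; have [n xn] := corner_exists x.
rewrite (infmx_mul_bound (n := n)) => [|k nk]; last first.
  by rewrite xn ?nk ?orbT // r0mul.
by apply: ideal_sum => k _; apply: ideal_mulr; exact: Ix.
Qed.

Lemma mx_in_pre1 I (x y : infmx R) : pre1 x y -> mx_in I y -> mx_in I x.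
Proof. by move=> [s [t ->]] Iy; apply: mx_in_mulr; exact: mx_in_mull. Qed.

Lemma mx_in_oplus I (x y : infmx R) :
  mx_in I x -> mx_in I y -> mx_in I (oplus x y).
Proof.
move=> Ix Iy i j; rewrite blockE.
by case: ifP => _; case: ifP => _; rewrite ?Ix ?Iy //; exact: ideal0.
Qed.

(* I is decomposable, resp. quasipure. *)
Definition decomposable I : Prop :=
  forall x : infmx R, mx_in I x -> exists2 y : infmx R, mx_in I y & pre1 x y.

Definition quasipure I : Prop :=
  forall x : infmx R, mx_in I x ->
    exists s y : infmx R, [/\ mx_in I s, mx_in I y, s ** y = y & pre1 x y].

Lemma quasipure_decomposable I : quasipure I -> decomposable I.
Proof. by move=> qI x /qI [s [y [_ Iy _ xy]]]; exists y. Qed.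

Section IdealGen.
Variable A : set R.

Let gen : set R := \bigcap_(J in [set J : ideal | A `<=` J]) J.

Lemma ideal_gen0 : gen 0.
Proof. by move=> J _; exact: ideal0. Qed.
Lemma ideal_genB x y : gen x -> gen y -> gen (x - y).
Proof. by move=> gx gy J AJ; apply: idealB; [exact: gx|exact: gy]. Qed.
Lemma ideal_genMl a x : gen x -> gen (a ** x).
Proof. by move=> gx J AJ; apply: ideal_mull; exact: gx. Qed.
Lemma ideal_genMr a x : gen x -> gen (x ** a).
Proof. by move=> gx J AJ; apply: ideal_mulr; exact: gx. Qed.

Definition ideal_gen : ideal :=
  Ideal ideal_gen0 ideal_genB ideal_genMl ideal_genMr.

Lemma sub_ideal_gen : A `<=` ideal_gen.
Proof. by move=> x Ax /= J AJ; exact: AJ. Qed.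

Lemma ideal_gen_sub (J : ideal) : A `<=` J -> ideal_gen `<=` J.
Proof. by move=> AJ x /= gx; exact: (gx J). Qed.

End IdealGen.

Definition mx_single (i j : nat) (r : R) : infmx R.
Proof.
refine (@mkinfmx R (fun k l => if (k == i) && (l == j) then r else 0)
  (maxn i j).+1 _).
by move=> k l h; case: ifP => // /andP[/eqP ki /eqP lj]; exfalso; lia.
Defined.

Lemma mx_singleE i j r k l :
  mx_single i j r k l = if (k == i) && (l == j) then r else 0.
Proof. by []. Qed.

Lemma mx_single_sum (x : infmx R) n : corner_bound x n ->
  x = \sum_(i < n) \sum_(j < n) mx_single i j (x i j).
Proof.
move=> xn; apply: infmxP => k l; rewrite infmx_sumE.
under eq_bigr => i _ do rewrite infmx_sumE.
case: (ltnP k n) => [kn|kn]; last first.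
  rewrite xn ?kn // big1 // => i _; rewrite big1 // => j _.
  by rewrite mx_singleE; case: ifP => // /andP[/eqP e _]; have := ltn_ord i; lia.
case: (ltnP l n) => [ln|ln]; last first.
  rewrite xn ?ln ?orbT // big1 // => i _; rewrite big1 // => j _.
  by rewrite mx_singleE; case: ifP => // /andP[_ /eqP e]; have := ltn_ord j; lia.
rewrite (bigD1 (Ordinal kn)) //= (bigD1 (Ordinal ln)) //= !eqxx /=.
rewrite big1 => [|j jl]; last first.
  by case: eqP => // e; case/eqP: jl; apply: val_inj.
rewrite big1 => [|i ik]; first by rewrite !addr0.
rewrite big1 // => j _; case: eqP => // e.
by case/eqP: ik; apply: val_inj.
Qed.

Lemma mx_single_mull i j a r : mx_single i j (a ** r) =
  mx_single i i a ** mx_single i j r.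
Proof.
apply: infmxP => k l; rewrite mx_singleE.
rewrite (infmx_mul_bound (n := i.+1)) => [|m im]; last first.
  by rewrite !mx_singleE (gtn_eqF im) andbF r0mul.
rewrite (bigD1 ord_max) //= !eqxx big1 => [|m mi]; last first.
  rewrite (_ : (m == i :> nat) = false) ?andbF ?r0mul //.
  by apply: contraNF mi => /eqP e; apply/eqP/val_inj.
by rewrite addr0 andbT; case: (k == i); case: (l == j); rewrite ?r0mul ?rmul0.
Qed.

Lemma mx_single_mulr i j a r : mx_single i j (r ** a) =
  mx_single i j r ** mx_single j j a.
Proof.
apply: infmxP => k l; rewrite mx_singleE.
rewrite (infmx_mul_bound (n := j.+1)) => [|m im]; last first.
  by rewrite !mx_singleE (gtn_eqF im) andbF r0mul.
rewrite (bigD1 ord_max) //= !eqxx big1 => [|m mi]; last first.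
  rewrite (_ : (m == j :> nat) = false) ?andbF ?r0mul //.
  by apply: contraNF mi => /eqP e; apply/eqP/val_inj.
by rewrite addr0 andbT; case: (k == i); case: (l == j); rewrite ?r0mul ?rmul0.
Qed.

Lemma mx_singleB i j r s :
  mx_single i j (r - s) = mx_single i j r + mx_single i j (- s).
Proof.
apply: infmxP => k l; rewrite infmx_addE !mx_singleE.
by case: ifP; rewrite ?addr0.
Qed.

(* W-domination by a family closed under oplus passes to sums of ideals. *)
Lemma ideal_gen_dominated (A : set ideal) (W : set (infmx R)) :
    W 0 -> (forall x y, W x -> W y -> W (oplus x y)) ->
    (forall I, A I -> forall x, mx_in I x -> exists2 y, W y & pre1 x y) ->
  forall x, mx_in (ideal_gen (\bigcup_(I in A) I)) x ->
    exists2 y, W y & pre1 x y.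
Proof.
move=> W0 WD WA x gx; pose D := [set x : infmx R | exists2 y, W y & pre1 x y].
have D0 : D 0 by exists 0 => //; exact: pre1_zero.
have DD u v : D u -> D v -> D (u + v).
  move=> [y Wy uy] [z Wz vz]; exists (oplus y z); first exact: WD.
  exact: pre1_add.
have DMl s u : D u -> D (s ** u).
  move=> [y Wy [a [b ->]]]; exists y => //; exists (s ** a), b.
  by rewrite !rmulA.
have DMr s u : D u -> D (u ** s).
  move=> [y Wy [a [b ->]]]; exists y => //; exists a, (b ** s).
  by rewrite !rmulA.
have DN u : D u -> D (- u).
  move=> [y Wy [a [b ->]]]; exists y => //; exists (- a), b.
  by rewrite !rmulNr.
have DB r s i j : D (mx_single i j r) -> D (mx_single i j s) ->
    D (mx_single i j (r - s)).
  move=> Dr Ds; rewrite mx_singleB; apply: DD => //.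
  rewrite (_ : mx_single i j (- s) = - mx_single i j s); first exact: DN.
  apply: infmxP => k l; rewrite mx_singleE.
  rewrite [RHS](_ : _ = - (mx_single i j s k l)) // mx_singleE.
  by case: ifP; rewrite ?oppr0.
have s0 i j : mx_single i j 0 = 0.
  by apply: infmxP => k l; rewrite mx_singleE; case: ifP.
pose GI := @Ideal [set r | forall i j, D (mx_single i j r)].
have [G GE] : exists G : ideal, (G : set R) =
    [set r | forall i j, D (mx_single i j r)].
  unshelve eexists (GI _ _ _ _) => //=.
  - by move=> i j; rewrite s0.
  - by move=> r s hr hs i j; exact: DB.
  - by move=> a r hr i j; rewrite mx_single_mull; exact: DMl.
  - by move=> a r hr i j; rewrite mx_single_mulr; exact: DMr.
have AG : \bigcup_(I in A) I `<=` G.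
  move=> r [I AI Ir]; rewrite GE => i j; apply: (WA I AI) => k l.
  by rewrite mx_singleE; case: ifP => // _; exact: ideal0.
have [n xn] := corner_exists x; rewrite (mx_single_sum xn).
apply: (big_ind D) => // i _; apply: (big_ind D) => // j _.
have := ideal_gen_sub AG (gx i j); rewrite GE; exact.
Qed.

Lemma decomposable_gen (A : set ideal) :
  (forall I, A I -> decomposable I) ->
  decomposable (ideal_gen (\bigcup_(I in A) I)).
Proof.
move=> dA; set S := ideal_gen _; apply: (@ideal_gen_dominated A (mx_in S)).
- by move=> i j; exact: ideal0.
- exact: mx_in_oplus.
- move=> I AI x /(dA I AI)[y Iy xy]; exists y => // i j.
  by apply: sub_ideal_gen; exists I.
Qed.

Lemma quasipure_gen (A : set ideal) :
  (forall I, A I -> quasipure I) ->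
  quasipure (ideal_gen (\bigcup_(I in A) I)).
Proof.
move=> qA; set S := ideal_gen _.
have AS I x : A I -> mx_in I x -> mx_in S x.
  by move=> AI Ix i j; apply: sub_ideal_gen; exists I.
move=> x Sx.
have [|||y [s [Ss Sy syy]] xy] := @ideal_gen_dominated A
  [set y | exists s, [/\ mx_in S s, mx_in S y & s ** y = y]] _ _ _ x Sx.
- by exists 0; split; rewrite ?rmul0 // => i j; exact: ideal0.
- move=> y z [s [Ss Sy sy]] [t [St Sz tz]].
  exists (block (mxsize y) (mxsize y) s 0 0 t); split.
  + move=> i j; rewrite blockE.
    by case: ifP => _; case: ifP => _; rewrite ?Ss ?St //; exact: ideal0.
  + exact: mx_in_oplus.
  + rewrite block_mul => [|k hk]; last first.
      by right => j; split=> //; apply: mxsize_bound; rewrite hk.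
    by rewrite !(r0mul, rmul0, addr0, add0r) sy tz.
- move=> I AI y /(qA I AI)[s [z [Is Iz sz yz]]].
  by exists z => //; exists s; split => //; exact: AS AI _.
- by exists s, y.
Qed.

End Ideals.

(* Lat_d(R) and Lat_qp(R), ordered by inclusion. *)
Record Latd (R : rngType) := LatD {
  Latd_val :> ideal R;
  LatdP : `[< decomposable Latd_val >]
}.

HB.instance Definition _ (R : rngType) := [isSub for @Latd_val R].
HB.instance Definition _ (R : rngType) := [Choice of Latd R by <:].
HB.instance Definition _ (R : rngType) :=
  [SubChoice_isSubPOrder of Latd R by <: with inclusion_display].

Record Latqp (R : rngType) := LatQp {
  Latqp_val :> ideal R;
  LatqpP : `[< quasipure Latqp_val >]
}.

HB.instance Definition _ (R : rngType) := [isSub for @Latqp_val R].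
HB.instance Definition _ (R : rngType) := [Choice of Latqp R by <:].
HB.instance Definition _ (R : rngType) :=
  [SubChoice_isSubPOrder of Latqp R by <: with inclusion_display].

Section LatIdeals.
Variable R : rngType.

Lemma Latqp_to_Latd_subproof (I : Latqp R) : `[< decomposable I >].
Proof.
by apply/asboolP/quasipure_decomposable/asboolP; exact: LatqpP.
Qed.

Definition Latqp_to_Latd (I : Latqp R) : Latd R :=
  LatD (Latqp_to_Latd_subproof I).

Lemma Latd_gen_subproof (F : set (Latd R)) :
  `[< decomposable (ideal_gen (\bigcup_(I in @Latd_val R @` F) I)) >].
Proof.
apply/asboolP/decomposable_gen => _ [I _ <-].
by apply/asboolP; exact: LatdP.
Qed.

Lemma Latd_sups_exist (F : set (Latd R)) : exists s, supremums F s.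
Proof.
exists (LatD (Latd_gen_subproof F)); split => [J FJ|K FK].
  apply/asboolP => x Jx; by apply: sub_ideal_gen; exists J => //; exists J.
apply/asboolP; apply: ideal_gen_sub => x [_ [J FJ <-] Jx].
by have /asboolP := FK J FJ; apply.
Qed.

HB.instance Definition _ :=
  POrder_hasSups.Build inclusion_display (Latd R) Latd_sups_exist.

Lemma Latqp_gen_subproof (F : set (Latqp R)) :
  `[< quasipure (ideal_gen (\bigcup_(I in @Latqp_val R @` F) I)) >].
Proof.
apply/asboolP/quasipure_gen => _ [I _ <-].
by apply/asboolP; exact: LatqpP.
Qed.

Lemma Latqp_sups_exist (F : set (Latqp R)) : exists s, supremums F s.
Proof.
exists (LatQp (Latqp_gen_subproof F)); split => [J FJ|K FK].
  apply/asboolP => x Jx; by apply: sub_ideal_gen; exists J => //; exists J.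
apply/asboolP; apply: ideal_gen_sub => x [_ [J FJ <-] Jx].
by have /asboolP := FK J FJ; apply.
Qed.

HB.instance Definition _ :=
  POrder_hasSups.Build inclusion_display (Latqp R) Latqp_sups_exist.

End LatIdeals.

Section RngQuotient.
Variables (R : rngType) (I : ideal R).

Definition ideal_pred : {pred R} := [pred x | `[< I x >]].

Lemma ideal_predP x : reflect (I x) (x \in ideal_pred).
Proof. exact: asboolP. Qed.

Lemma ideal_zmod_closed : zmod_closed ideal_pred.
Proof.
split=> [|x y /ideal_predP Ix /ideal_predP Iy]; apply/ideal_predP.
  exact: ideal0.
exact: idealB.
Qed.

HB.instance Definition _ := GRing.isZmodClosed.Build R ideal_pred
  ideal_zmod_closed.

(* The quotient ring R/I. *)
Definition rng_quot : Type := {ideal_quot ideal_pred}.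
HB.instance Definition _ := GRing.Zmodule.on rng_quot.
HB.instance Definition _ :=
  EqQuotient.copy rng_quot {ideal_quot ideal_pred}.

Definition rng_quot_mul (a b : rng_quot) : rng_quot :=
  \pi_rng_quot (repr a ** repr b).

End RngQuotient.

Section RngQuotientMul.
Variables (R : rngType) (I : ideal R).
Notation Q := (rng_quot I).
Implicit Types a b c : Q.

Lemma rng_quotP x y : (\pi_Q x = \pi_Q y) <-> I (x - y).
Proof.
by split=> [/eqP|] h; [apply/ideal_predP|apply/eqP];
  move: h; rewrite -(Quotient.idealrBE (ideal_pred I)) => // /ideal_predP.
Qed.

Lemma rng_quot_repr x : I (repr (\pi_Q x) - x).
Proof. by apply/rng_quotP; rewrite reprK. Qed.

Lemma rng_quot_mul_pi x y :
  rng_quot_mul (\pi_Q x) (\pi_Q y) = \pi_Q (x ** y).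
Proof.
apply/rng_quotP; set x' := repr _; set y' := repr _.
have -> : x' ** y' - x ** y = (x' - x) ** y' + x ** (y' - y).
  by rewrite rmulDl rmulDr rmulNr rmulrN addrA subrK.
by apply: idealD; [apply: ideal_mulr|apply: ideal_mull]; exact: rng_quot_repr.
Qed.

Lemma rng_quot_add_pi x y : \pi_Q x + \pi_Q y = \pi_Q (x + y).
Proof. by rewrite (@Quotient.pi_add _ (ideal_pred I)). Qed.

Lemma rng_quot_mulA : associative (@rng_quot_mul R I).
Proof.
move=> a b c; elim/quotW: a => x; elim/quotW: b => y; elim/quotW: c => z.
rewrite (rng_quot_mul_pi x y) (rng_quot_mul_pi y z).
by rewrite (rng_quot_mul_pi x) (rng_quot_mul_pi _ z) rmulA.
Qed.

Lemma rng_quot_mulDl : left_distributive (@rng_quot_mul R I) +%R.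
Proof.
move=> a b c; elim/quotW: a => x; elim/quotW: b => y; elim/quotW: c => z.
rewrite (rng_quot_mul_pi x z) (rng_quot_mul_pi y z) !rng_quot_add_pi.
by rewrite (rng_quot_mul_pi _ z) rmulDl.
Qed.

Lemma rng_quot_mulDr : right_distributive (@rng_quot_mul R I) +%R.
Proof.
move=> a b c; elim/quotW: a => x; elim/quotW: b => y; elim/quotW: c => z.
rewrite (rng_quot_mul_pi x y) (rng_quot_mul_pi x z) !rng_quot_add_pi.
by rewrite (rng_quot_mul_pi x _) rmulDr.
Qed.

HB.instance Definition _ := Zmodule_isRng.Build (rng_quot I)
  rng_quot_mulA rng_quot_mulDl rng_quot_mulDr.

End RngQuotientMul.

Section LambdaIdeal.
Variables (R : rngType) (I : ideal R).

(* Lambda_R(I). *)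
Definition LambdaI_set : set (Lambda R) :=
  [set a | exists2 x : incseq R,
     (forall n, mx_in I (x n)) & a = \pi_(Lambda R) x].

Lemma LambdaI_precsim (x y : incseq R) : precsim x y ->
  (forall n, mx_in I (y n)) -> forall n, mx_in I (x n).
Proof.
by move=> xy Iy n; have [m xm] := xy n; apply: mx_in_pre1 xm _; exact: Iy.
Qed.

Lemma LambdaI_down (a b : Lambda R) :
  (a <= b)%O -> LambdaI_set b -> LambdaI_set a.
Proof.
elim/quotW: a => x /[swap] -[y Iy ->] /Lambda_le_pi xy.
by exists x => //; exact: LambdaI_precsim xy Iy.
Qed.

Lemma LambdaI_pi (x : incseq R) :
  LambdaI_set (\pi_(Lambda R) x) <-> forall n, mx_in I (x n).
Proof.
split=> [[y Iy /eqP/Lambda_piP[xy _]]|Ix]; last by exists x.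
exact: LambdaI_precsim xy Iy.
Qed.

Lemma LambdaI0 : LambdaI_set pom0.
Proof. by exists (zero_seq R) => // n i j; exact: ideal0. Qed.

Lemma LambdaID (a b : Lambda R) :
  LambdaI_set a -> LambdaI_set b -> LambdaI_set (a +p b).
Proof.
move=> [x Ix ->] [y Iy ->]; rewrite [_ +p _]Lambda_add_pi.
by exists (oplus_seq x y) => // n; exact: mx_in_oplus.
Qed.

Lemma LambdaI_sup (u : nat -> Lambda R) (s : Lambda R) :
  {homo u : m n / (m <= n)%N >-> (m <= n)%O} ->
  (forall n, LambdaI_set (u n)) -> supremums (range u) s -> LambdaI_set s.
Proof.
move=> _ Iu [_ su].
have /choice[X XP] : forall k, exists x : incseq R,
    (forall n, mx_in I (x n)) /\ u k = \pi_(Lambda R) x.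
  by move=> k; have [x] := Iu k; exists x.
apply: (@LambdaI_down _ (\pi_(Lambda R) (sup_seq X))).
  apply: su => _ [k _ <-]; have [_ ->] := XP k.
  by apply/Lambda_le_pi; exact: sup_seq_ge.
apply/LambdaI_pi; apply: mx_in_sup_seq; first exact: ideal0.
by move=> k; have [] := XP k.
Qed.

Definition LambdaI : pideal (Lambda R) := PIdeal
  (ex_intro _ _ LambdaI0) LambdaID LambdaI_down LambdaI_sup.

(* S(I), seen as the subset of S(R) intersecting Lambda_R(I); see SI_image.   *)
Definition SI_set : set (Smon R) := [set a | LambdaI (a : Lambda R)].

Lemma SI_down (a b : Smon R) : (a <= b)%O -> SI_set b -> SI_set a.
Proof. by rewrite leEsub; exact: LambdaI_down. Qed.

Lemma SI_sup (u : nat -> Smon R) (s : Smon R) :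
  {homo u : m n / (m <= n)%N >-> (m <= n)%O} ->
  (forall n, SI_set (u n)) -> supremums (range u) s -> SI_set s.
Proof.
move=> _ Iu [_ su].
have /choice[X XP] : forall k, exists x : incseq R,
    [/\ forall n, mx_in I (x n), calS R x & (u k : Lambda R) = \pi x].
  move=> k; have := Iu k; have /S_predP[x Sx e] := Smon_valP (u k).
  by rewrite /SI_set /= e => /LambdaI_pi Ix; exists x.
have SX : calS R (sup_seq X) by apply: calS_sup_seq => k; have [] := XP k.
apply: (@SI_down _ (SMon (S_pred_pi SX))).
  apply: su => _ [k _ <-]; have [_ _ e] := XP k.
  by rewrite leEsub /= e; apply/Lambda_le_pi; exact: sup_seq_ge.
apply/LambdaI_pi; apply: mx_in_sup_seq; first exact: ideal0.
by move=> k; have [] := XP k.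
Qed.

Definition SI : pideal (Smon R) := @PIdeal (Smon R) SI_set
  (ex_intro _ (Smon_zero R) LambdaI0)
  (fun a b => @LambdaID (Smon_val a) (Smon_val b)) SI_down SI_sup.

End LambdaIdeal.

Section SubRng.
Variables (R : rngType) (I : ideal R).

(* The ideal I as a ring. *)
Definition sub_rng : Type := {x : R | x \in ideal_pred I}.
HB.instance Definition _ := SubChoice.on sub_rng.
HB.instance Definition _ := [SubChoice_isSubZmodule of sub_rng by <:].

Lemma sub_rng_mul_subproof (x y : sub_rng) : val x ** val y \in ideal_pred I.
Proof. by apply/ideal_predP/ideal_mull/ideal_predP; exact: valP. Qed.
Definition sub_rng_mul (x y : sub_rng) : sub_rng :=
  Sub (val x ** val y) (sub_rng_mul_subproof x y).

Lemma sub_rng_mulA : associative sub_rng_mul.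
Proof. by move=> x y z; apply: val_inj; rewrite !SubK rmulA. Qed.
Lemma sub_rng_mulDl : left_distributive sub_rng_mul +%R.
Proof. by move=> x y z; apply: val_inj; rewrite !raddfD !SubK rmulDl. Qed.
Lemma sub_rng_mulDr : right_distributive sub_rng_mul +%R.
Proof. by move=> x y z; apply: val_inj; rewrite !raddfD !SubK rmulDr. Qed.

HB.instance Definition _ := Zmodule_isRng.Build sub_rng
  sub_rng_mulA sub_rng_mulDl sub_rng_mulDr.

Lemma val_sub_rng0 : val (0 : sub_rng) = 0.
Proof. exact: raddf0. Qed.

Lemma sub_infmx_subproof (x : infmx sub_rng) :
  finite_set [set ij : nat * nat | val (x ij.1 ij.2) != 0].
Proof.
apply: sub_finite_set (infmx_finite x) => -[i j] /=.
by apply: contra => /eqP ->; apply/eqP; exact: val_sub_rng0.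
Qed.
Definition sub_infmx (x : infmx sub_rng) : infmx R :=
  @InfMx R (fun i j => val (x i j)) (sub_infmx_subproof x).

Lemma sub_infmxM (x y : infmx sub_rng) :
  sub_infmx (x ** y) = sub_infmx x ** sub_infmx y.
Proof.
apply: infmxP => i j; have [n xn] := corner_exists x.
have vE (z : infmx sub_rng) k l : sub_infmx z k l = val (z k l) by [].
rewrite vE !(infmx_mul_bound (n := n)).
- by rewrite raddf_sum; exact: eq_bigr.
- by move=> k nk; rewrite xn ?nk ?orbT // r0mul.
- by move=> k nk; rewrite vE xn ?nk ?orbT // val_sub_rng0 r0mul.
Qed.

Lemma sub_incseq_subproof (x : incseq sub_rng) n :
  pre1 (sub_infmx (x n)) (sub_infmx (x n.+1)).
Proof.
have [s [t ->]] := incseq_pre1 x n.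
by exists (sub_infmx s), (sub_infmx t); rewrite !sub_infmxM.
Qed.
Definition sub_incseq (x : incseq sub_rng) : incseq R :=
  IncSeq (sub_incseq_subproof x).

Lemma sub_infmx_inj : injective sub_infmx.
Proof.
move=> x y /(congr1 (@infmx_fun R)) e; apply: infmxP => i j; apply: val_inj.
exact: (congr1 (fun f => f i j) e).
Qed.

Lemma sub_infmx_lift (x : infmx R) : mx_in I x -> exists y, sub_infmx y = x.
Proof.
move=> Ix.
have Px i j : x i j \in ideal_pred I by apply/ideal_predP; exact: Ix.
have fin : finite_set [set ij : nat * nat |
    (Sub (x ij.1 ij.2) (Px ij.1 ij.2) : sub_rng) != 0].
  apply: sub_finite_set (infmx_finite x) => -[i j] /=.
  by apply: contra => /eqP e; apply/eqP/val_inj; rewrite SubK val_sub_rng0.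
exists (@InfMx sub_rng (fun i j => Sub (x i j) (Px i j)) fin).
by apply: infmxP => i j /=.
Qed.

(* SI is the image of S(I), for I considered as a ring, in S(R).              *)
Lemma SI_image (a : Smon R) : SI I a <->
  exists2 x : incseq sub_rng,
    calS sub_rng x & (a : Lambda R) = \pi_(Lambda R) (sub_incseq x).
Proof.
split=> [|[x Sx e]]; last first.
  rewrite /SI /= /SI_set /= e; apply/LambdaI_pi => n i j.
  by apply/ideal_predP; exact: valP.
have /S_predP[x Sx e] := Smon_valP a.
rewrite /SI /= /SI_set /= e => /LambdaI_pi Ix.
have /choice[y yP] : forall n, exists y, sub_infmx y = x n.
  by move=> n; exact: sub_infmx_lift.
have Sy n : exists z, y n = z ** y n.+1 ** y n.
  have [z zP] := Sx n.
  have [|w wP] := @sub_infmx_lift (z ** x n.+1 ** z).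
    by apply: mx_in_mulr; apply: mx_in_mull.
  exists w; apply: sub_infmx_inj; rewrite !sub_infmxM wP !yP.
  by rewrite -!rmulA [z ** (_ ** x n)]rmulA -!zP rmulA -zP.
have yinc n : pre1 (y n) (y n.+1).
  by have [z] := Sy n; exact: calS_pre1.
exists (IncSeq yinc) => //.
by congr (\pi_(Lambda R) _); apply: incseqP => n; rewrite /= yP.
Qed.

End SubRng.

Definition retract d d' (P : porderType d) (Q : porderType d') : Prop :=
  exists (phi : P -> Q) (psi : Q -> P),
    [/\ {homo phi : x y / (x <= y)%O}, {homo psi : x y / (x <= y)%O}
      & cancel phi psi].

(* The ordered subset P of Q, included by i, is complete as a lattice, and    *)
(* arbitrary suprema in P are suprema in Q. Infima are only computed in P: in *)
(* the ring of upper triangular 2 x 2 matrices over a field, the ideals       *)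
(* generated by e11 and by e22 are quasipure, but their intersection, which   *)
(* is their infimum in Lat_d, is a nonzero ideal of square zero, hence is not *)
(* quasipure.                                                                 *)
Definition complete_sublattice d d' (P : porderType d) (Q : porderType d')
    (i : P -> Q) : Prop :=
  [/\ {mono i : x y / (x <= y)%O},
      forall F : set P, exists2 s, supremums F s & supremums (i @` F) (i s)
    & forall F : set P, exists t, infimums F t].

(* Main.v *)
Require Import Defs.
From HB Require Import structures.
From mathcomp Require Import all_boot all_order all_algebra.
From mathcomp Require Import all_classical.

(** Ideals of the ring R and ideals of Lambda(R) or S(R) are both determined
    by sets of finitary matrices closed under domination and diagonal sums.
    Indeed, for an ideal J of either monoid, the matrices dominated by a term
    of a sequence with class in J are exactly the matrices over some ideal I
    of R ([ideal_of_dominated]): the conditions on J make the set of these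
    terms directed, and the matrix units needed to pass between a matrix and
    its entries are absorbed by the two factors of a domination. Conversely a
    class belongs to J as soon as all its terms are matrices over I, because it
    then lies below the supremum of a sequence of classes in J
    ([pideal_LambdaI]).

    Decomposability of I says that every matrix over I starts a sequence over
    I for domination, and quasipurity says that every matrix over I lies below
    a sequence over I satisfying the relations of S(R): from s y = y and
    s = a y' b one gets y = a (y' b) y, and y' b inherits the left unit of y'.
    Both conditions thus become one notion, [covered], relative to the class of
    sequences considered, and Lambda(R) and S(R) are treated at the same time
    as instances of [seq_model]. The isomorphisms of lattices follow, and so do
    the statements on sublattices and retracts, since quasipure ideals are
    closed under sums: the retraction sends an ideal to its largest quasipure
    subideal.

    For the quotients, the map is induced by reduction modulo I. Its kernel is
    controlled by the fact that a domination modulo I lifts to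
    x_n = s y_m t + d with d over I, hence x_n is dominated by y_m (+) z as
    soon as z dominates d; the sequences z obtained for all n are amalgamated
    by their supremum ([precsim_quot_oplus]). The remaining point is
    surjectivity, and reduction even turns out to be surjective on sequences.
    When I is decomposable, lifts x_n of the terms are corrected to
    x_n (+) z_n, with z_n over I chosen recursively to dominate the errors
    ([decomposable_lift]). For S(R) the relation x_n = y_n x_(n+1) x_n only
    holds up to an error d_n over I, and diagonal corrections do not help. One
    replaces x_n by the block triangular matrix
<<
       w_n = [ x_n  0   ]
             [ c_n  z_n ]
>>
    where c_n and z_n are over I, d_n is a left multiple of c_n, and the common
    left unit s_n of c_n and z_n over I is recovered from the next z_(n+1) by
    a left factor which annihilates c_(n+1). In the product w_(n+1) w_n such a
    factor reads off c_n and z_n from the lower row, which gives the error term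
    d_n and hence the whole of w_n ([quasipure_lift]). *)

Set Implicit Arguments.
Unset Strict Implicit.
Unset Printing Implicit Defensive.

Import Order.TTheory GRing.Theory.
Local Open Scope classical_set_scope.
Local Open Scope quotient_scope.
Local Open Scope ring_scope.

(** * Choice, lattice isomorphisms and quotient monoids *)

Section Generalities.

(** The invariant S is what makes the next choice possible; it is carried by
    the chosen sequence itself. *)
Lemma indexed_dependent_choice (T : Type) (S : set T)
    (E : nat -> T -> T -> Prop) (t0 : T) :
    S t0 -> (forall n t, S t -> exists2 t', S t' & E n t t') ->
  exists u : nat -> T,
    [/\ u 0%N = t0, forall n, S (u n) & forall n, E n (u n) (u n.+1)].
Proof.
move=> St0 step.
have /choice[f fP] (nt : nat * T) :
    exists t', S nt.2 -> S t' /\ E nt.1 nt.2 t'.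
  have [/(step nt.1)|nS] := pselect (S nt.2); last by exists t0.
  by move=> [t' St' Et']; exists t'.
pose u := fix u n := if n is m.+1 then f (m, u m) else t0.
have Su n : S (u n) by elim: n => //= n IH; exact: (fP (n, u n) IH).1.
by exists u; split=> // n; exact: (fP (n, u n) (Su n)).2.
Qed.

Lemma order_iso_lmorphism d d' (L : latticeType d) (L' : latticeType d')
    (f : L -> L') :
    {mono f : x y / (x <= y)%O} -> (forall y, exists x, f x = y) ->
  exists g : {lmorphism L -> L'}, bijective g.
Proof.
move=> fmono /choice[h hK].
have fK : cancel f h by move=> x; apply: le_anti; rewrite -!fmono !hK lexx.
have fhomo : {homo f : x y / (x <= y)%O} by move=> x y; rewrite fmono.
have fI : {morph f : x y / Order.meet x y >-> Order.meet x y}.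
  move=> x y; apply: le_anti; rewrite lexI !fmono leIl leIr /=.
  by rewrite -[leLHS]hK fmono lexI -!fmono hK leIl leIr.
have fU : {morph f : x y / Order.join x y >-> Order.join x y}.
  move=> x y; apply: le_anti; rewrite leUx !fmono leUl leUr /= andbT.
  by rewrite -[leRHS]hK fmono leUx -!fmono hK leUl leUr.
pose om := Order.isOrderMorphism.Build d L d' L' f fhomo.
pose mm := Order.isMeetLatticeMorphism.Build d L d' L' f fI.
pose jm := Order.isJoinLatticeMorphism.Build d L d' L' f fU.
pose g : {lmorphism L -> L'} := HB.pack f om mm jm.
by exists g; exists h.
Qed.

Lemma infimums_exist d (P : porderType d) :
    (forall F : set P, exists s, supremums F s) ->
  forall F : set P, exists t, infimums F t.
Proof.
move=> sups F; have [t [ubt lubt]] := sups (lbound F).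
by exists t; split=> [x Fx|x]; [apply: lubt => y; exact|exact: ubt].
Qed.

(** The first isomorphism theorem for positively ordered monoids. It
    preserves 0 because g is onto: the image of 0 lies below every element. *)
Lemma pquot_iso (M N : pomType) (J : pideal M) (g : M -> N) :
    (forall a b, (g a <= g b)%O <-> lemod J a b) ->
    {morph g : a b / a +p b} -> (forall c, exists a, g a = c) ->
  exists f : pquot J -> N, pom_iso f.
Proof.
move=> gle gD gsurj; have [h hK] := choice gsurj.
pose f (a : pquot J) : N := g (repr a).
have fmono : {mono f : a b / (a <= b)%O}.
  move=> a b; apply/idP/idP => [/gle ab|/asboolP/gle//].
  by apply/asboolP.
have fpi a : f (\pi_(pquot J) a) = g a.
  have [ar ra] := pquot_repr J a.
  by apply: le_anti; apply/andP; split; apply/gle.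
have fsurj c : f (\pi_(pquot J) (h c)) = c by rewrite fpi hK.
exists f; split=> //.
- exists (fun c => \pi_(pquot J) (h c)) => // a.
  by apply: le_anti; rewrite -!fmono !fsurj lexx.
- apply: le_anti; rewrite pom0_le andbT -[leRHS]fsurj fmono.
  exact: pom0_le.
- by move=> a b; rewrite [_ +p _ in LHS]/(pquot_add a b) fpi gD.
Qed.

End Generalities.

(** * Matrices dominated by a directed set *)

Section DominatedMatrices.
Variable R : rngType.
Implicit Types (x y z s t : infmx R) (I : ideal R).

Lemma row_move_subproof x i k : exists n,
  corner_bound (fun a b => if a == i then x k b else 0) n.
Proof.
have [n xn] := corner_exists x; exists (maxn n i.+1) => a b; rewrite !geq_max.
case: eqP => // -> /orP[/andP[_]|/andP[nb _]]; first by rewrite ltnn.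
by rewrite xn ?nb ?orbT.
Qed.

Lemma col_move_subproof x j l : exists n,
  corner_bound (fun a b => if b == j then x a l else 0) n.
Proof.
have [n xn] := corner_exists x; exists (maxn n j.+1) => a b; rewrite !geq_max.
case: eqP => // -> /orP[/andP[na _]|/andP[_]]; last by rewrite ltnn.
by rewrite xn ?na.
Qed.

(** If x = s y t, the entry (k, l) of x is the product of row k of s, of y and
    of column l of t; moving this row and this column to positions i and j
    isolates the entry without using matrix units over R. *)
Lemma pre1_mx_single x y i j k l :
  pre1 x y -> pre1 (mx_single i j (x k l)) y.
Proof.
move=> [s [t ->]].
have [[m s'm] [n t'n]] := (row_move_subproof s i k, col_move_subproof t j l).
exists (mkinfmx s'm), (mkinfmx t'n).
apply: infmxP => a b; have [p yp] := corner_exists y.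
have sy (u : infmx R) c c' : (p <= c')%N -> (u ** y) c c' = 0.
  exact: mulmx_colbound.
have mulE (u v : infmx R) c d :
    (u ** y ** v) c d = \sum_(f < p) (u ** y) c f ** v f d.
  by rewrite (infmx_mul_bound (n := p)) // => f /(sy u c) ->; rewrite r0mul.
have rowE (u v : infmx R) c d f : (forall g, u c g = v d g) ->
    (u ** y) c f = (v ** y) d f.
  move=> uv; rewrite !(infmx_mul_bound (n := p)) => [| |] *; last 2 first.
  - by rewrite yp ?rmul0 //; apply/orP; left.
  - by rewrite yp ?rmul0 //; apply/orP; left.
  by apply: eq_bigr => g _; rewrite uv.
rewrite mx_singleE !mulE; have [->|ai] := eqVneq a i; last first.
  rewrite [LHS]/= big1 // => f _; rewrite (rowE _ 0 _ 0%N) ?r0mul // => g /=.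
  by rewrite (negPf ai).
have [->|bj] := eqVneq b j; last first.
  by rewrite [LHS]/= big1 // => f _ /=; rewrite (negPf bj) rmul0.
apply: eq_bigr => f _; rewrite [mkinfmx t'n _ _]/= eqxx; congr (_ ** _).
by apply: rowE => g /=; rewrite eqxx.
Qed.

(** The set D of matrices dominated by W is closed under sums because
    s y t + s' y' t' is a row times y (+) y' times a column. It is then
    determined by the entries of its members, which form an ideal. *)
Lemma ideal_of_dominated (W : set (infmx R)) : W !=set0 ->
    (forall x y, W x -> W y -> exists2 z, W z & pre1 (oplus x y) z) ->
  exists I, forall x, mx_in I x <-> exists2 y, W y & pre1 x y.
Proof.
move=> [w0 Ww0] dirW; pose D := [set x : infmx R | exists2 y, W y & pre1 x y].
have D0 : D 0 by exists w0 => //; exact: pre1_zero.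
have DD u v : D u -> D v -> D (u + v).
  move=> [y Wy uy] [z Wz vz]; have [w Ww yzw] := dirW y z Wy Wz.
  by exists w => //; apply: pre1_trans yzw; exact: pre1_add.
have DMl s u : D u -> D (s ** u).
  move=> [y Wy [a [b ->]]]; exists y => //; exists (s ** a), b.
  by rewrite !rmulA.
have DMr s u : D u -> D (u ** s).
  move=> [y Wy [a [b ->]]]; exists y => //; exists a, (b ** s).
  by rewrite !rmulA.
have DN u : D u -> D (- u).
  by move=> [y Wy [a [b ->]]]; exists y => //; exists (- a), b; rewrite !rmulNr.
have sN i j r : mx_single i j (- r) = - mx_single i j r.
  apply: infmxP => k l.
  rewrite -[RHS]/(- (mx_single i j r k l)) !mx_singleE.
  by case: ifP => //; rewrite oppr0.
have s0 i j : mx_single i j 0 = 0.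
  by apply: infmxP => k l; rewrite mx_singleE; case: ifP.
unshelve eexists (@Ideal R [set r | forall i j, D (mx_single i j r)] _ _ _ _).
- by move=> i j; rewrite s0.
- by move=> r s hr hs i j; rewrite mx_singleB sN; apply: DD => //; exact: DN.
- by move=> a r hr i j; rewrite mx_single_mull; exact: DMl.
- by move=> a r hr i j; rewrite mx_single_mulr; exact: DMr.
move=> x; split=> [/= Ix|[y Wy xy] k l i j]; last first.
  by exists y => //; exact: pre1_mx_single.
have [n xn] := corner_exists x; rewrite (mx_single_sum xn).
by apply: (big_ind D) => // i _; apply: (big_ind D) => // j _; exact: Ix.
Qed.

End DominatedMatrices.

(** * Covering ideals by sequences *)

Section Sequences.
Variable R : rngType.
Implicit Types (x y z : incseq R) (X : nat -> incseq R) (P : set (incseq R)).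
Implicit Type I : ideal R.

Lemma sum_seq_le_sup X k : precsim (sum_seq X k) (sup_seq X).
Proof.
move=> n; exists (maxn k n.+1) => /=.
apply: (pre1_sum_seq (leq_maxl k n.+1)).
by apply: pre1_incseq; rewrite leq_maxr.
Qed.

Lemma sup_seq_le X z :
  (forall k, precsim (sum_seq X k) z) -> precsim (sup_seq X) z.
Proof. by move=> h n; exact: h. Qed.

Lemma le_sup_seq x X :
  (forall n, exists m, pre1 (x n) (X n m)) -> precsim x (sup_seq X).
Proof.
move=> h n; have [m xm] := h n; have [k mk] := sup_seq_ge X n m.
by exists k; exact: pre1_trans mk.
Qed.

Lemma oplus_asum x y : precsim (oplus_seq x y) (asum x y).
Proof. by have /eqP/Lambda_piP[] := asum_oplus x y. Qed.

(** This expresses decomposability and quasipurity uniformly: P is the class of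
    all sequences in the first case and calS R in the second. *)
Definition covered P I : Prop := forall d, mx_in I d ->
  exists z n, [/\ P z, forall k, mx_in I (z k) & pre1 d (z n)].

Lemma covered_decomposable P I : covered P I -> decomposable I.
Proof. by move=> cI d /cI[z [n [_ Iz dz]]]; exists (z n). Qed.

Lemma decomposable_covered I : decomposable I -> covered setT I.
Proof.
move=> dI d Id.
have [|u [u0 Iu uu]] :=
  @indexed_dependent_choice _ (mx_in I) (fun=> @pre1 R) d Id.
  by move=> _; exact: dI.
by exists (IncSeq uu), 1%N; split=> //=; rewrite -u0.
Qed.

Lemma covered_calS_quasipure I : covered (calS R) I -> quasipure I.
Proof.
move=> cI d /cI[z [n [Sz Iz dz]]]; have [s zs] := Sz n.
by exists (s ** z n.+1), (z n); split=> //; exact: mx_in_mull.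
Qed.

(** The recursion runs through pairs (s, y) over I with s y = y. Quasipurity
    applied to s gives s = a y' b with s' y' = y', and then (s', y' b) is the
    next pair, since y = s y = a (y' b) y. *)
Lemma quasipure_covered_calS I : quasipure I -> covered (calS R) I.
Proof.
move=> qI d /qI[s [y [Is Iy sy dy]]].
pose S := [set t : infmx R * infmx R |
  [/\ mx_in I t.1, mx_in I t.2 & t.1 ** t.2 = t.2]].
pose E (t t' : infmx R * infmx R) := exists v, t.2 = v ** t'.2 ** t.2.
have [||u [u0 Su Eu]] := @indexed_dependent_choice _ S (fun=> E) (s, y) => //.
  move=> _ [s1 y1] [/= Is1 _ sy1].
  have [s' [y' [Is' Iy' sy' [a [b sE]]]]] := qI s1 Is1.
  exists (s', y' ** b); first split=> //=; first exact: mx_in_mulr.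
    by rewrite rmulA sy'.
  by exists a; rewrite /= rmulA -sE sy1.
have uu n : pre1 (u n).2 (u n.+1).2 by have [v vE] := Eu n; exists v, (u n).2.
exists (IncSeq uu), 0%N; split=> // [k|]; first by have [] := Su k.
by rewrite /= u0.
Qed.

End Sequences.

(** * Monoids of classes of sequences and their ideals *)

(** The features shared by Lambda(R) and S(R): a submonoid of Lambda(R) with the
    induced order, consisting of the classes of a set of sequences which is
    stable under the constructions of sums and suprema. The sum is asum rather
    than oplus_seq, as only the former preserves calS R. *)
Record seq_model (R : rngType) (M : pomType) := SeqModel {
  model_emb :> M -> Lambda R;
  model_seqs : set (incseq R);
  model_embP : forall b : Lambda R, (exists a, model_emb a = b) <->
    exists2 x, model_seqs x & b = \pi_(Lambda R) x;
  model_mono : {mono model_emb : a b / (a <= b)%O};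
  model_embD : {morph model_emb : a b / a +p b};
  model_zero : model_seqs (zero_seq R);
  model_asum : forall x y,
    model_seqs x -> model_seqs y -> model_seqs (asum x y);
  model_sup : forall X, (forall k, model_seqs (X k)) -> model_seqs (sup_seq X)
}.

Section SeqModelTheory.
Variables (R : rngType) (M : pomType) (e : seq_model R M).
Implicit Types (a b : M) (x y : incseq R) (J : pideal M) (I : ideal R).
Notation P := (model_seqs e).

Definition represents a x := P x /\ e a = \pi_(Lambda R) x.

Lemma represented a : exists x, represents a x.
Proof.
have [/(_ (ex_intro _ a erefl)) [x Px ex] _] := model_embP e (e a).
by exists x.
Qed.

Lemma representing x : P x -> exists a, represents a x.
Proof.
move=> Px; have [|a ea] := (model_embP e (\pi_(Lambda R) x)).2;
  last by exists a.
by exists x.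
Qed.

Lemma represents_le a b x y : represents a x -> represents b y ->
  (a <= b)%O <-> precsim x y.
Proof.
by move=> [_ ea] [_ eb]; rewrite -(model_mono e) ea eb; exact: Lambda_le_pi.
Qed.

Lemma representsD a b x y : represents a x -> represents b y ->
  represents (a +p b) (asum x y).
Proof.
move=> [Px ea] [Py eb]; split; first exact: model_asum.
by rewrite model_embD ea eb asum_oplus [_ +p _]Lambda_add_pi.
Qed.

Lemma represents_LambdaI I a x : represents a x ->
  LambdaI_set I (e a) <-> forall n, mx_in I (x n).
Proof. by move=> [_ ->]; exact: LambdaI_pi. Qed.

(** A covered ideal is recovered from its classes: each r in I is an entry of a
    matrix dominated by a term of a sequence over I. *)
Lemma LambdaI_subset I I' : covered P I ->
  (forall a, LambdaI_set I (e a) -> LambdaI_set I' (e a)) -> I `<=` I'.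
Proof.
move=> cI II' r Ir; have [|z [n [Pz Iz rz]]] := cI (mx_single 0 0 r).
  by move=> i j; rewrite mx_singleE; case: ifP => // _; exact: ideal0.
have [a az] := representing Pz.
have /(represents_LambdaI _ az) I'z := II' a ((represents_LambdaI I az).2 Iz).
by have := mx_in_pre1 rz (I'z n); move/(_ 0%N 0%N); rewrite mx_singleE.
Qed.

(** I consists of the entries of the matrices dominated by a term of a sequence
    with class in J. If all terms x_n of a sequence are over I, each is
    dominated by some X_n with class in J, and the class of x lies below the
    supremum of the partial sums of the X_n, which J contains. *)
Lemma pideal_LambdaI J : exists2 I, covered P I &
  forall a, J a <-> LambdaI_set I (e a).
Proof.
pose A := [set x | exists2 a, J a & represents a x].
have AD x y : A x -> A y -> A (asum x y).
  move=> [a Ja ax] [b Jb bx]; exists (a +p b); first exact: pidealD.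
  exact: representsD.
have A_sup X : (forall k, A (X k)) -> A (sup_seq X).
  move=> AX; have Asum k : A (sum_seq X k).
    by elim: k => [|k IH]; [exact: AX|exact: AD].
  have [b bX] : exists b, represents b (sup_seq X).
    by apply/representing/model_sup => k; have [a _ []] := AX k.
  exists b => //; have /choice[u uP] k :
      exists a, J a /\ represents a (sum_seq X k).
    by have [a Ja ak] := Asum k; exists a.
  apply: (@pideal_sup _ J u) => [i j ij|n|].
  - apply/(represents_le (uP i).2 (uP j).2) => n; exists n.+1.
    by apply: (pre1_sum_seq ij); exact: incseq_pre1.
  - exact: (uP n).1.
  split=> [_ [k _ <-]|c ubc].
    by apply/(represents_le (uP k).2 bX); exact: sum_seq_le_sup.
  have [z cz] := represented c; apply/(represents_le bX cz)/sup_seq_le => k.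
  by apply/(represents_le (uP k).2 cz)/ubc; exists k.
have [||I IE] := @ideal_of_dominated R
  [set w | exists2 x, A x & exists n, w = x n].
- have [a az] := representing (model_zero e).
  exists (zero_seq R 0), (zero_seq R); last by exists 0%N.
  exists a => //; apply: pideal_down (pideal0 J).
  have [y y0] := represented pom0; apply/(represents_le az y0) => n.
  by exists 0%N; exact: pre1_zero.
- move=> _ _ [x Ax [n ->]] [y Ay [m ->]].
  have [k kP] := oplus_asum x y (maxn n m).+1.
  exists (asum x y k); first by exists (asum x y); [exact: AD|exists k].
  apply: pre1_trans kP.
  by apply: pre1_oplus; apply: pre1_incseq; rewrite ltnS ?leq_maxl ?leq_maxr.
have AI x : A x -> forall n, mx_in I (x n).
  move=> Ax n; apply/IE; exists (x n.+1); last exact: incseq_pre1.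
  by exists x => //; exists n.+1.
exists I => [d /IE[_ [x Ax [n ->]] dx]|a].
  by exists x, n; split=> //; [have [b _ []] := Ax|exact: AI].
have [x ax] := represented a; split=> [Ja|].
  by apply/(represents_LambdaI _ ax)/AI; exists a.
move/(represents_LambdaI _ ax) => Ix.
have /choice[X XP] n : exists y, A y /\ exists m, pre1 (x n) (y m).
  by have /IE[_ [y Ay [m ->]] xy] := Ix n; exists y; split=> //; exists m.
have [|b Jb bX] := A_sup X; first by move=> k; exact: (XP k).1.
apply: pideal_down Jb; apply/(represents_le ax bX)/le_sup_seq => n.
exact: (XP n).2.
Qed.

End SeqModelTheory.

(** * Matrices over a quotient ring *)

Section QuotientMatrices.
Variables (R : rngType) (I : ideal R).
Notation Q := (rng_quot I).
Implicit Types (x y z : infmx R) (u v : infmx Q).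

Lemma pi_quot0 : \pi_Q (0 : R) = 0.
Proof. by apply: (addrI (\pi_Q 0)); rewrite rng_quot_add_pi !addr0. Qed.

Lemma quot_mx_subproof x :
  finite_set [set ij : nat * nat | \pi_Q (x ij.1 ij.2) != 0].
Proof.
apply: sub_finite_set (infmx_finite x) => -[i j] /=.
by apply: contra => /eqP ->; rewrite pi_quot0.
Qed.

Definition quot_mx x : infmx Q :=
  @InfMx Q (fun i j => \pi_Q (x i j)) (quot_mx_subproof x).

Lemma quot_mx_surj u : exists x, quot_mx x = u.
Proof.
have [n un] := corner_exists u.
(* The truncation matters as repr 0 is only known to lie in I. *)
have cn : corner_bound (fun i j =>
    if (i < n)%N && (j < n)%N then repr (u i j) else 0 : R) n.
  by move=> i j; rewrite (leqNgt n i) (leqNgt n j) -negb_and => /negPf ->.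
exists (mkinfmx cn); apply: infmxP => i j /=.
case: ifPn => [_|]; first by rewrite reprK.
by rewrite negb_and -!leqNgt pi_quot0 => /un ->.
Qed.

Lemma quot_mxP x y : quot_mx x = quot_mx y <-> mx_in I (x - y).
Proof.
split=> [e i j|Ixy].
  by apply/rng_quotP; exact: (congr1 (fun u : infmx Q => u i j) e).
by apply: infmxP => i j; apply/rng_quotP; exact: Ixy.
Qed.

Lemma quot_mxM x y : quot_mx (x ** y) = quot_mx x ** quot_mx y.
Proof.
apply: infmxP => i j; have [n xn] := corner_exists x.
have piE z k l : quot_mx z k l = \pi_Q (z k l) by [].
rewrite piE !(infmx_mul_bound (n := n)) => [|k nk|k nk].
- have piD a b := esym (rng_quot_add_pi I a b).
  rewrite (big_morph (\pi_Q) piD pi_quot0).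
  by apply: eq_bigr => k _; rewrite -rng_quot_mul_pi.
- by rewrite piE xn ?nk ?orbT // pi_quot0 r0mul.
- by rewrite xn ?nk ?orbT // r0mul.
Qed.

Lemma quot_mx_block p q x y z t : quot_mx (block p q x y z t) =
  block p q (quot_mx x) (quot_mx y) (quot_mx z) (quot_mx t).
Proof. by apply: infmxP => i j /=; case: ifP => _; case: ifP. Qed.

Lemma quot_mx_in x : mx_in I x -> quot_mx x = 0.
Proof.
move=> Ix; apply: infmxP => i j /=; rewrite -pi_quot0.
by apply/rng_quotP; rewrite subr0.
Qed.

Lemma quot_mx0 : quot_mx 0 = 0.
Proof. by apply: quot_mx_in => i j; exact: ideal0. Qed.

Lemma corner_blockl (S : zmodType) p q (x : infmx S) :
    (forall k j, (p <= k)%N -> x k j = 0) ->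
    (forall k i, (q <= k)%N -> x i k = 0) ->
  block p q x 0 0 0 = x.
Proof.
move=> xp xq; apply: infmxP => i j /=.
have [ip|/xp ->] := ltnP; last by case: ifP.
by have [//|/xq ->] := ltnP.
Qed.

(** Only the upper left block survives in R/I, and as it is padded with zeros
    it is x itself modulo I: block extensions over I do not change a matrix
    modulo I on the nose, not just up to equivalence. *)
Lemma quot_mx_corner p q x y z :
    (forall k j, (p <= k)%N -> x k j = 0) ->
    (forall k i, (q <= k)%N -> x i k = 0) ->
    mx_in I y -> mx_in I z ->
  quot_mx (block p q x 0 y z) = quot_mx x.
Proof.
move=> xp xq Iy Iz.
rewrite quot_mx_block quot_mx0 (quot_mx_in Iy) (quot_mx_in Iz) corner_blockl //.
  by move=> k j pk /=; rewrite xp ?pi_quot0.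
by move=> k i qk /=; rewrite xq ?pi_quot0.
Qed.

Lemma quot_mx_oplus x z : mx_in I z -> quot_mx (oplus x z) = quot_mx x.
Proof.
move=> Iz; apply: quot_mx_corner => //.
- by move=> k j pk; apply: mxsize_bound; rewrite pk.
- by move=> k j pk; apply: mxsize_bound; rewrite pk orbT.
- by move=> i j; exact: ideal0.
Qed.

Lemma quot_mx_pre1 x y : pre1 x y -> pre1 (quot_mx x) (quot_mx y).
Proof.
by move=> [s [t ->]]; exists (quot_mx s), (quot_mx t); rewrite !quot_mxM.
Qed.

Lemma pre1_quot_mx x y : pre1 (quot_mx x) (quot_mx y) ->
  exists2 d, mx_in I d & pre1 (x - d) y.
Proof.
move=> [s' [t']].
have [s <-] := quot_mx_surj s'; have [t <-] := quot_mx_surj t'.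
rewrite -!quot_mxM => /quot_mxP Id; exists (x - s ** y ** t) => //.
by exists s, t; rewrite opprB addrC subrK.
Qed.

Lemma pre1_oplus_ideal x y z d :
  pre1 (x - d) y -> pre1 d z -> pre1 x (oplus y z).
Proof. by move=> h /(pre1_add h); rewrite subrK. Qed.

End QuotientMatrices.

(** * Sequences over a quotient ring *)

Section QuotientSequences.
Variables (R : rngType) (I : ideal R).
Notation Q := (rng_quot I).
Implicit Types (x y z : incseq R) (u v : incseq Q).

Definition quot_seq x : incseq Q :=
  IncSeq (fun n => quot_mx_pre1 I (incseq_pre1 x n)).

Lemma quot_seq_precsim x y : precsim x y -> precsim (quot_seq x) (quot_seq y).
Proof.
by move=> xy n; have [m xm] := xy n; exists m; exact: quot_mx_pre1.
Qed.

(** Equality may fail, as reduction modulo I can shrink the corner of x_n. *)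
Lemma quot_seq_oplus x y :
  precsim (quot_seq (oplus_seq x y)) (oplus_seq (quot_seq x) (quot_seq y)) /\
  precsim (oplus_seq (quot_seq x) (quot_seq y)) (quot_seq (oplus_seq x y)).
Proof.
split=> n; exists n.+1; rewrite /= quot_mx_block quot_mx0; apply: pre1_block;
  try exact: (incseq_pre1 (quot_seq _)); move=> k j h.
- by apply: mxsize_bound; rewrite h.
- by apply: mxsize_bound; rewrite h orbT.
- by rewrite /= mxsize_bound ?h ?pi_quot0.
- by rewrite /= mxsize_bound ?h ?orbT ?pi_quot0.
Qed.

Lemma quot_seq_asum x y :
  precsim (quot_seq (asum x y)) (asum (quot_seq x) (quot_seq y)) /\
  precsim (asum (quot_seq x) (quot_seq y)) (quot_seq (asum x y)).
Proof.
have [qo oq] := quot_seq_oplus x y.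
have /eqP/Lambda_piP[ao oa] := asum_oplus x y.
have /eqP/Lambda_piP[ao' oa'] := asum_oplus (quot_seq x) (quot_seq y).
split; first exact: precsim_trans (precsim_trans (quot_seq_precsim ao) qo) oa'.
exact: precsim_trans (precsim_trans ao' oq) (quot_seq_precsim oa).
Qed.

Lemma calS_quot_seq x : calS R x -> calS Q (quot_seq x).
Proof.
move=> Sx n; have [y yP] := Sx n; exists (quot_mx I y).
by rewrite /= -!quot_mxM -yP.
Qed.

Lemma precsim_oplus_quot x y z : (forall n, mx_in I (z n)) ->
  precsim x (oplus_seq y z) -> precsim (quot_seq x) (quot_seq y).
Proof.
move=> Iz xyz n; have [m xm] := xyz n; exists m.
by have := quot_mx_pre1 I xm; rewrite /= quot_mx_oplus.
Qed.

(** A domination modulo I is a domination up to an error d_n over I. As I is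
    covered, d_n lies below a sequence Z_n over I, and one z serves all n: the
    supremum of the Z_n. *)
Lemma precsim_quot_oplus (P : set (incseq R)) x y : covered P I ->
    (forall X, (forall k, P (X k)) -> P (sup_seq X)) ->
    precsim (quot_seq x) (quot_seq y) ->
  exists z, [/\ P z, forall n, mx_in I (z n) & precsim x (oplus_seq y z)].
Proof.
move=> cI Psup xy.
have /choice[Z ZP] n : exists z, [/\ P z, forall k, mx_in I (z k) &
    exists m l, pre1 (x n) (oplus (y m) (z l))].
  have [m /pre1_quot_mx[d Id xdy]] := xy n.
  have [z [l [Pz Iz dz]]] := cI d Id.
  by exists z; split=> //; exists m, l; exact: pre1_oplus_ideal dz.
exists (sup_seq Z); split.
- by apply: Psup => k; have [] := ZP k.
- by apply: mx_in_sup_seq; [exact: ideal0|move=> k; have [] := ZP k].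
move=> n; have [_ _ [m [l xml]]] := ZP n.
have [k lk] := sup_seq_ge Z n l; exists (maxn m.+1 k).
apply: pre1_trans xml _; apply: pre1_oplus.
  by apply: pre1_incseq; rewrite leq_maxl.
exact: pre1_incseq_trans (leq_maxr _ _) lk.
Qed.

(** If the x_n lift u and x_n = s x_(n+1) t + d_n with d_n over I, then
    x_n (+) z_n is dominated by x_(n+1) (+) z_(n+1) when z_(n+1) = z1 (+) z2,
    where z1 dominates d_n and z2 dominates z_n. *)
Lemma decomposable_lift u : decomposable I -> exists x, quot_seq x = u.
Proof.
move=> dI; have /choice[x xE] n := quot_mx_surj (u n).
have xS n : exists2 d, mx_in I d & pre1 (x n - d) (x n.+1).
  by apply: pre1_quot_mx; rewrite !xE; exact: incseq_pre1.
have step n (z : infmx R) : mx_in I z -> exists2 z', mx_in I z' &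
    pre1 (oplus (x n) z) (oplus (x n.+1) z').
  move=> Iz; have [d Id xd] := xS n.
  have [z1 Iz1 dz1] := dI d Id; have [z2 Iz2 zz2] := dI z Iz.
  exists (oplus z1 z2); first exact: mx_in_oplus.
  by rewrite oplusA; apply: pre1_oplus zz2; exact: pre1_oplus_ideal dz1.
have [|z [_ Iz zz]] := indexed_dependent_choice (t0 := 0) _ step.
  by move=> i j; exact: ideal0.
by exists (IncSeq zz); apply: incseqP => n; rewrite /= quot_mx_oplus ?xE.
Qed.

(** The recursive step of the lifting. By quasipurity d = a y1 a' and
    t = b y2 b', where y1 and y2 have left units s1 and s2 over I. Stacking
    y1 a' above and y2 b' below a common cut q gives the columns y and z: the
    rows (a 0) and (0 b) then separate them, and diag(s1, s2) is a left unit of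
    both. *)
Lemma quasipure_pair (d t : infmx R) : quasipure I -> mx_in I d -> mx_in I t ->
  exists y z s : infmx R,
    [/\ [/\ mx_in I y, mx_in I z, mx_in I s, s ** y = y & s ** z = z],
        exists a, a ** y = d /\ a ** z = 0 &
        exists b, b ** y = 0 /\ b ** z = t].
Proof.
move=> qI /qI[s1 [y1 [Is1 Iy1 sy1 [a [a' dE]]]]].
move=> /qI[s2 [y2 [Is2 Iy2 sy2 [b [b' tE]]]]].
pose q := mxsize y1; pose c := y1 ** a'; pose e := y2 ** b'.
have cq k j : (q <= k)%N -> c k j = 0.
  move=> qk; rewrite (infmx_mul_bound (n := 0)) ?big_ord0 // => l _.
  by rewrite mxsize_bound ?qk ?r0mul.
have Iblock p r (u v w t' : infmx R) : mx_in I u -> mx_in I v -> mx_in I w ->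
    mx_in I t' -> mx_in I (block p r u v w t').
  move=> Iu Iv Iw It i j; rewrite blockE.
  by case: ifP => _; case: ifP => _; [exact: Iu|exact: Iv|exact: Iw|exact: It].
have I0 : mx_in I (0 : infmx R) by move=> i j; exact: ideal0.
have block0 (u v w t' : infmx R) : block 0 0 u v w t' = t'.
  by apply: infmxP => i j /=; rewrite !subn0.
have hc (u v : infmx R) k : (q <= k)%N ->
    (forall i, u i k = 0 /\ v i k = 0) \/
    (forall j, (0 : infmx R) k j = 0 /\ c k j = 0).
  by move=> qk; right=> j; split=> //; exact: cq.
exists (block q 0 0 c 0 0), (block q 0 0 0 0 e), (block q q s1 0 0 s2).
split; first split.
- by apply: Iblock => //; exact: mx_in_mulr.
- by apply: Iblock => //; exact: mx_in_mulr.
- exact: Iblock.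
- rewrite block_mul; last exact: hc.
  by rewrite !(r0mul, rmul0, addr0, add0r) rmulA sy1.
- rewrite block_mul => [|k _]; last by right.
  by rewrite !(r0mul, rmul0, addr0, add0r) rmulA sy2.
- exists (block 0 q 0 0 a 0); split.
    by rewrite block_mul; [rewrite block0 r0mul addr0 rmulA -dE|exact: hc].
  by rewrite block_mul => [|k _]; [rewrite block0 rmul0 r0mul addr0|right].
- exists (block 0 q 0 0 0 b); split.
    by rewrite block_mul; [rewrite block0 rmul0 r0mul addr0|exact: hc].
  rewrite block_mul => [|k _]; last by right.
  by rewrite block0 r0mul add0r rmulA -tE.
Qed.

(** Write s_n for the left unit of c_n and z_n, and let a c_n = d_n, a z_n = 0,
    b c_(n+1) = 0, b z_(n+1) = s_n. The lower row of w_(n+1) w_n is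
    (c_(n+1) x_n + z_(n+1) c_n, z_(n+1) z_n), which b maps to (c_n, z_n) and
    a b to (d_n, 0). Since y_n x_(n+1) x_n + d_n = x_n, the matrix with rows
    (y_n, a b) and (0, b) maps w_(n+1) w_n to w_n. *)
Lemma quasipure_lift u : quasipure I -> calS Q u ->
  exists2 x, calS R x & quot_seq x = u.
Proof.
move=> qI Su; have /choice[x xE] n := quot_mx_surj (u n).
have /choice[y yP] n :
    exists y : infmx R, mx_in I (x n - y ** x n.+1 ** x n).
  have [y' u_n] := Su n; have [y yE] := quot_mx_surj y'; exists y.
  by apply/quot_mxP; rewrite !quot_mxM !xE yE.
pose d n := x n - y n ** x n.+1 ** x n.
(* The states are the triples (c, z, s); only s is passed to the next step. *)
pose S := [set t : infmx R * infmx R * infmx R |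
  [/\ mx_in I t.1.1, mx_in I t.1.2, mx_in I t.2,
      t.2 ** t.1.1 = t.1.1 & t.2 ** t.1.2 = t.1.2]].
pose E n (t t' : infmx R * infmx R * infmx R) :=
  (exists a, a ** t'.1.1 = d n /\ a ** t'.1.2 = 0) /\
  (exists b, b ** t'.1.1 = 0 /\ b ** t'.1.2 = t.2).
have [|n t [_ _ It _ _]|t [_ St Et]] :=
  @indexed_dependent_choice _ S E (0, 0, 0).
- by split; rewrite /= ?rmul0 // => i j; exact: ideal0.
- have [c [z [s [[Ic Iz Is sc sz] ca bz]]]] := quasipure_pair qI (yP n) It.
  by exists (c, z, s).
pose c n := (t n.+1).1.1; pose z n := (t n.+1).1.2.
(* p n bounds the columns of x n and the rows of x n.-1, hence cuts the
   columns of w n and the rows of w n.-1 at the same place. *)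
pose p n := maxn (mxsize (x n)) (mxsize (x n.-1)).
have xr n k j : (p n.+1 <= k)%N -> x n k j = 0.
  by rewrite geq_max => /andP[_ h]; apply: mxsize_bound; rewrite h.
have xc n k i : (p n <= k)%N -> x n i k = 0.
  by rewrite geq_max => /andP[h _]; apply: mxsize_bound; rewrite h orbT.
pose w n := block (p n.+1) (p n) (x n) 0 (c n) (z n).
have wS n : exists v : infmx R, w n = v ** w n.+1 ** w n.
  have [[a [ac az]] _] := Et n; have [_ [b [bc bz]]] := Et n.+1.
  have [_ _ _ sc sz] := St n.+1.
  exists (block (p n.+1) (p n.+2) (y n) (a ** b) 0 b).
  rewrite block_mul => [|k h]; last by right=> j; split=> //; exact: xr.
  rewrite block_mul => [|k h]; last by right=> j; split=> //; exact: xr.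
  rewrite -[(t n.+2).1.1]/(c n.+1) -[(t n.+2).1.2]/(z n.+1) in bc bz *.
  rewrite -[(t n.+1).1.1]/(c n) -[(t n.+1).1.2]/(z n) in ac az sc sz *.
  have bc' (v : infmx R) : b ** (c n.+1 ** v) = 0 by rewrite rmulA bc r0mul.
  have bz' (v : infmx R) : b ** (z n.+1 ** v) = (t n.+1).2 ** v.
    by rewrite rmulA bz.
  rewrite !(rmul0, r0mul, add0r) -!rmulA bc bc' !bz' sc sz ac az.
  by rewrite !(rmul0, addr0, add0r) /d addrC subrK.
have ww n : pre1 (w n) (w n.+1) by have [v vE] := wS n; exists v, (w n).
exists (IncSeq ww) => //; apply: incseqP => n; rewrite /= quot_mx_corner ?xE //.
- exact: xr.
- exact: xc.
- by have [] := St n.+1.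
- by have [] := St n.+1.
Qed.

End QuotientSequences.

(** * Reduction modulo an ideal, and the two monoids *)

Section QuotientModel.
Variables (R : rngType) (I : ideal R) (M M' : pomType).
Variables (e : seq_model R M) (e' : seq_model (rng_quot I) M') (K : pideal M).

(** Reduction induces the map, by [precsim_quot_oplus] the congruence it defines
    is the one attached to K, and the lifting of sequences makes it onto. *)
Lemma model_quotient_iso :
    (forall a, K a <-> LambdaI_set I (e a)) -> covered (model_seqs e) I ->
    (forall x, model_seqs e x -> model_seqs e' (quot_seq I x)) ->
    (forall u, model_seqs e' u ->
       exists2 x, model_seqs e x & quot_seq I x = u) ->
  exists f : pquot K -> M', pom_iso f.
Proof.
move=> KE cI e_e' lift.
have /choice[g gP] a : exists c, exists x,
    represents e a x /\ represents e' c (quot_seq I x).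
  have [x ax] := represented e a.
  have [c cx] := representing (e_e' x ax.1).
  by exists c, x.
have g_le a b : (g a <= g b)%O <-> lemod K a b.
  have [x [ax gx]] := gP a; have [y [b_y gy]] := gP b.
  split=> [/(represents_le gx gy) xy|[c /KE Kc]].
    have [z [Pz Iz xyz]] := precsim_quot_oplus cI (model_sup (s := e)) xy.
    have [c cz] := representing Pz.
    exists c; first by apply/KE/(represents_LambdaI I cz).
    apply/(represents_le ax (representsD b_y cz)).
    exact: precsim_trans (oplus_asum y z).
  have [z cz] := represented e c; have Iz := (represents_LambdaI I cz).1 Kc.
  move=> /(represents_le ax (representsD b_y cz)) xyz.
  apply/(represents_le gx gy)/(precsim_oplus_quot Iz)/(precsim_trans xyz).
  by have /eqP/Lambda_piP[] := asum_oplus y z.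
apply: (@pquot_iso _ _ _ g) => // [a b|c].
  have [x [ax gx]] := gP a; have [y [b_y gy]] := gP b.
  have [w [abw gw]] := gP (a +p b).
  have abxy := representsD ax b_y; have gxy := representsD gx gy.
  have [qa aq] := quot_seq_asum I x y.
  apply: le_anti; apply/andP; split.
    apply/(represents_le gw gxy)/(precsim_trans _ qa)/quot_seq_precsim.
    exact/(represents_le abw abxy).
  apply/(represents_le gxy gw)/(precsim_trans aq)/quot_seq_precsim.
  exact/(represents_le abxy abw).
have [u cu] := represented e' c; have [x Px xu] := lift u cu.1.
have [a ax] := representing Px; exists a; have [y [ay gy]] := gP a.
have xy : (precsim x y) /\ (precsim y x).
  by split; [apply/(represents_le ax ay)|apply/(represents_le ay ax)].
rewrite -xu in cu.
by apply: le_anti; apply/andP; split; [apply/(represents_le gy cu)|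
  apply/(represents_le cu gy)]; apply: quot_seq_precsim; case: xy.
Qed.

End QuotientModel.

Section Models.
Variable R : rngType.

Lemma Lambda_model_embP (b : Lambda R) : (exists a, id a = b) <->
  exists2 x, [set: incseq R] x & b = \pi_(Lambda R) x.
Proof.
split=> [_|[x _ ->]]; last by exists (\pi_(Lambda R) x).
by elim/quotW: b => x; exists x.
Qed.

Definition Lambda_model : seq_model R (Lambda R) :=
  @SeqModel R (Lambda R) id setT Lambda_model_embP (fun _ _ => erefl)
    (fun _ _ => erefl) I (fun _ _ _ _ => I) (fun _ _ => I).

Lemma Smon_model_embP (b : Lambda R) : (exists a, @Smon_val R a = b) <->
  exists2 x, calS R x & b = \pi_(Lambda R) x.
Proof.
split=> [[a <-]|[x Sx ->]]; first exact/S_predP/Smon_valP.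
by exists (SMon (S_pred_pi Sx)).
Qed.

Definition Smon_model : seq_model R (Smon R) :=
  @SeqModel R (Smon R) (@Smon_val R) (calS R) Smon_model_embP
    (fun _ _ => erefl) (fun _ _ => erefl) (@calS_zero R) (@calS_asum R)
    (@calS_sup_seq R).

End Models.

(** Both lattices of ideals of R are posets L of covered ideals, for the two
    models. The inclusion order on covered ideals is reflected by
    [LambdaI_subset], and [pideal_LambdaI] shows that no ideal of M is
    missed. *)
Lemma covered_lat_iso (R : rngType) (M : pomType) (e : seq_model R M) d
    (L : latticeType d) (v : L -> ideal R) (K : ideal R -> pideal M) :
    {mono v : i j / (i <= j)%O} ->
    (forall I, covered (model_seqs e) I <-> exists i, v i = I) ->
    (forall I a, K I a <-> LambdaI_set I (e a)) ->
  exists f : {lmorphism L -> Lat M}, bijective f.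
Proof.
move=> vmono vP KE; apply: (@order_iso_lmorphism _ _ _ _ (K \o v)).
  move=> i j; rewrite -vmono; apply/asboolP/asboolP => ij /=.
    apply: (@LambdaI_subset _ _ e) => [|a]; first by apply/vP; exists i.
    by move/KE => Ka; apply/KE; exact: ij.
  move=> a /KE[x Ix ea]; apply/KE; exists x => // n k l; exact/ij/Ix.
move=> J; have [I cI IE] := pideal_LambdaI e J.
have [i vi] := (vP I).1 cI; exists i; apply/pideal_inj/seteqP.
by split=> a /=; rewrite vi => ?; [apply/IE/KE|apply/KE/IE].
Qed.

Theorem theoremA (R : rngType) :
  (* (i) *)
  ((exists f : {lmorphism Latd R -> Lat (Lambda R)}, bijective f) /\
   (exists g : {lmorphism Latqp R -> Lat (Smon R)}, bijective g)) /\
  (* (ii) *)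
  (complete_sublattice (@Latqp_to_Latd R) /\ retract (Latqp R) (Latd R)) /\
  (* (iii) *)
  (forall I : ideal R, decomposable I ->
     (exists f : pquot (LambdaI I) -> Lambda (rng_quot I), pom_iso f) /\
     (quasipure I ->
        exists g : pquot (SI I) -> Smon (rng_quot I), pom_iso g)).
Proof.
split; first split.
- apply: (covered_lat_iso (e := Lambda_model R) (v := @Latd_val R)
    (K := @LambdaI R)) => // I; split=> [/covered_decomposable dI|[J <-]].
    by exists (LatD (asboolT dI)).
  by apply/decomposable_covered/asboolP; exact: LatdP.
- apply: (covered_lat_iso (e := Smon_model R) (v := @Latqp_val R)
    (K := @SI R)) => // I; split=> [/covered_calS_quasipure qI|[J <-]].
    by exists (LatQp (asboolT qI)).
  by apply/quasipure_covered_calS/asboolP; exact: LatqpP.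
split; first split.
- split=> // [F|]; last exact/infimums_exist/Latqp_sups_exist.
  have FG J : F J -> J `<=` ideal_gen (\bigcup_(I in @Latqp_val R @` F) I).
    by move=> FJ x Jx; apply: sub_ideal_gen; exists J => //; exists J.
  exists (LatQp (Latqp_gen_subproof F)); split.
  + by move=> J /FG FJ; apply/asboolP.
  + move=> K FK; apply/asboolP; apply: ideal_gen_sub => x [_ [J FJ <-] Jx].
    by have /asboolP := FK J FJ; apply.
  + by move=> _ [J /FG FJ <-]; apply/asboolP.
  + move=> K FK; apply/asboolP; apply: ideal_gen_sub => x [_ [J FJ <-] Jx].
    by have /asboolP := FK _ (ex_intro2 _ _ J FJ erefl); apply.
(* The retraction takes I to the sum of the quasipure ideals inside I. *)
- have /choice[psi psiP] (I : Latd R) := Latqp_sups_exist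
    [set J : Latqp R | (Latqp_to_Latd J <= I)%O].
  exists (@Latqp_to_Latd R), psi; split=> // [I I' II'|J].
    apply: (psiP I).2 => J JI; apply: (psiP I').1.
    exact: le_trans II'.
  apply: le_anti; apply/andP; split.
    by apply: (psiP _).2 => J'.
  by apply: (psiP _).1; exact: lexx.
move=> I dI; split=> [|qI].
  apply: (model_quotient_iso (e := Lambda_model R)
    (e' := Lambda_model (rng_quot I))) => //; first exact: decomposable_covered.
  by move=> u _; have [x] := decomposable_lift u dI; exists x.
apply: (model_quotient_iso (e := Smon_model R)
  (e' := Smon_model (rng_quot I))) => // [||u].
- exact: quasipure_covered_calS.
- exact: calS_quot_seq.
- exact: quasipure_lift.
Qed.
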